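(* Let $d\ge 1$ be an integer, and let $c:(0,\infty)\to(0,\infty)$ be a $C^1$ function such that $c'>0$ on $(0,\infty)$ and $c/c'$ is concave on $(0,\infty)$. Set, for $x>0$, $$G(x)=\int_0^x c(y)\,dy,\qquad H(x)=\int_0^x c(y)\log c(y)\,dy.$$ Then for any $f\in C^1_{b,0}(\mathbb{R}^d)$, $$\int_{\mathbb{R}^d}H(f)\,d\gamma_d\le\frac12\int_{\mathbb{R}^d}c'(f)\,|\nabla f|^2\,d\gamma_d+H\circ G^{-1}\bigl(\|G(f)\|_1\bigr),$$ where $G^{-1}$ is the inverse function of $G$.
   Context: $\gamma_d$ is the standard Gaussian measure on $\mathbb{R}^d$ and $\|g\|_1=\int|g|\,d\gamma_d$. $C^1_{b,0}(\mathbb{R}^d)$ is the set of bounded $C^1$ functions $f:\mathbb{R}^d\to\mathbb{R}$ with bounded derivatives and $\inf_{x\in\mathbb{R}^d}f(x)>0$. $|\cdot|$ is the Euclidean norm. *)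

(* Defs.v *)
From HB Require Import structures.
From mathcomp Require Import all_boot all_order all_algebra.
From mathcomp Require Import all_classical all_reals all_analysis.

Set Implicit Arguments.
Unset Strict Implicit.
Unset Printing Implicit Defensive.

Import Order.TTheory GRing.Theory Num.Theory.
Import numFieldNormedType.Exports.

Local Open Scope classical_set_scope.
Local Open Scope ring_scope.

Definition measure_rV_display : measure_display -> measure_display.
Proof. exact. Qed.

(* The product sigma-algebra on row vectors, as the library has it on tuples;
   for T = R it is the Borel sigma-algebra of R^n. *)
Section measurable_rV.
Context {d} {T : measurableType d}.
Variable n : nat.

Let coors : 'I_n -> 'rV[T]_n -> T := fun i x => x ord0 i.

Let rV_set0 : g_sigma_preimage coors set0.
Proof. exact: sigma_algebra0. Qed.

Let rV_setC A : g_sigma_preimage coors A -> g_sigma_preimage coors (~` A).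
Proof. exact: sigma_algebraC. Qed.

Let rV_bigcup (F : _^nat) : (forall i, g_sigma_preimage coors (F i)) ->
  g_sigma_preimage coors (\bigcup_i (F i)).
Proof. exact: sigma_algebra_bigcup. Qed.

HB.instance Definition _ := @isMeasurable.Build (measure_rV_display d)
  'rV[T]_n (g_sigma_preimage coors) rV_set0 rV_setC rV_bigcup.

End measurable_rV.

Lemma measurable_coord d (T : measurableType d) n (i : 'I_n) :
  measurable_fun [set: 'rV[T]_n] (fun x : 'rV[T]_n => x ord0 i).
Proof.
move=> _ Y mY; rewrite setTI; apply: sub_sigma_algebra => /=.
rewrite -bigcup_seq/=; exists i => /=; first by rewrite mem_index_enum.
by exists Y => //; rewrite setTI.
Qed.

Lemma measurable_fun_coordP d1 d2 (T1 : measurableType d1)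
    (T2 : measurableType d2) n (f : T1 -> 'rV[T2]_n) :
  (forall i, measurable_fun [set: T1] (fun x => f x ord0 i)) ->
  measurable_fun [set: T1] f.
Proof.
move=> mf.
suff h : g_sigma_preimage (fun i x => f x ord0 i) `<=` measurable.
  move=> _ A mA; apply: h.
  by rewrite (g_sigma_preimage_comp (fun i (x : 'rV[T2]_n) => x ord0 i) f);
    exists A.
apply: smallest_sub; first exact: sigma_algebra_measurable.
case: n => [|n] in f mf *; first by rewrite big_ord0.
rewrite -bigcup_mkord_ord; apply: bigcup_sub => i Ii A [B mB <-].
exact: mf.
Qed.

Section std_gaussian.
Context {R : realType}.

Definition cons_rV d (p : measurableTypeR R * 'rV[R]_d) : 'rV[R]_d.+1 :=
  row_mx (p.1)%:M p.2.

Lemma cons_rV0 d (p : measurableTypeR R * 'rV[R]_d) : cons_rV p ord0 ord0 = p.1.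
Proof.
rewrite /cons_rV (_ : ord0 = lshift d (ord0 : 'I_1)); last exact/val_inj.
by rewrite (row_mxEl (p.1)%:M p.2) mxE eqxx mulr1n.
Qed.

Lemma cons_rVS d (p : measurableTypeR R * 'rV[R]_d) (j : 'I_d) :
  cons_rV p ord0 (lift ord0 j) = p.2 ord0 j.
Proof. by rewrite -rshift1; exact: (row_mxEr (p.1)%:M p.2). Qed.

Lemma measurable_cons_rV d :
  measurable_fun [set: measurableTypeR R * 'rV[R]_d] (@cons_rV d).
Proof.
apply: measurable_fun_coordP => i; case: (unliftP ord0 i) => [j|] ->.
  rewrite (_ : (fun _ => _) = (fun y : 'rV[R]_d => y ord0 j) \o snd).
    by apply: measurableT_comp => //; exact: measurable_coord.
  by apply/funext => p; exact: cons_rVS.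
rewrite (_ : (fun _ => _) = fst) //; apply/funext => p; exact: cons_rV0.
Qed.

HB.instance Definition _ d := isMeasurableFun.Build _ _ _ _
  (@cons_rV d) (@measurable_cons_rV d).

(* The first coordinate lives in measurableTypeR R, the copy of R on which the
   library defines normal_prob; its sigma-algebra is that of R. *)
Fixpoint std_gaussian (d : nat) : probability 'rV[R]_d R :=
  match d with
  | 0 => \d_(0 : 'rV[R]_0)
  | d'.+1 => distribution
      ((normal_prob (0 : R) 1 : probability (measurableTypeR R) R)
         \x std_gaussian d')%E
      (@cons_rV d')
  end.

Lemma std_gaussian_box d (A : 'I_d -> set R) : (forall i, measurable (A i)) ->
  std_gaussian d [set x | forall i, A i (x ord0 i)] =
  (\prod_(i < d) normal_prob 0 1 (A i))%E.
Proof.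
elim: d A => [|d IHd] A mA.
  by rewrite big_ord0 /= diracE mem_set// => -[].
rewrite big_ord_recl -IHd//= /distribution /pushforward.
have mB : measurable [set x : 'rV[R]_d | forall i, A (lift ord0 i) (x ord0 i)].
  have -> : [set x : 'rV[R]_d | forall i, A (lift ord0 i) (x ord0 i)] =
      \bigcap_(i in [set: 'I_d])
        ((fun x : 'rV[R]_d => x ord0 i) @^-1` A (lift ord0 i)).
    by apply/seteqP; split=> x /= => [h i _|h i]; [exact: h|exact: (h i I)].
  apply: fin_bigcap_measurable => // i _.
  by rewrite -[X in measurable X]setTI; exact: measurable_coord.
apply: etrans (product_measure1E
  (normal_prob (0 : R) 1 : probability (measurableTypeR R) R)
  (std_gaussian d) (mA ord0) mB).
congr ((_ \x _)%E _); apply/seteqP; split=> x /=.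
  move=> h; split=> [|i]; first by have := h ord0; rewrite cons_rV0.
  by have := h (lift ord0 i); rewrite cons_rVS.
move=> [h0 hS] i; case: (unliftP ord0 i) => [j|] ->.
  by rewrite cons_rVS.
by rewrite cons_rV0.
Qed.

End std_gaussian.

Section gradient.
Context {R : realType} {d : nat}.

(* The library's norm on row vectors is the sup norm. *)
Definition enorm (v : 'rV[R]_d) : R := Num.sqrt (\sum_(i < d) v ord0 i ^+ 2).

Definition grad (f : 'rV[R]_d -> R) (x : 'rV[R]_d) : 'rV[R]_d :=
  \row_(i < d) 'D_(delta_mx ord0 i) f x.

Definition C1_b_0 (f : 'rV[R]_d -> R) : Prop :=
  [/\ (forall x, differentiable f x) /\ continuous (grad f),
      exists M, forall x, `|f x| <= M,
      exists M, forall x, enorm (grad f x) <= M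
    & 0 < inf (range f)].

End gradient.

Section real_functions.
Context {R : realType}.
Local Notation mu := (@lebesgue_measure R).

Definition concave_function (D : set R) (f : R -> R) : Prop :=
  convex_function D (fun x => - f x).

Definition primG (c : R -> R) (x : R) : R := \int[mu]_(y in `]0, x]) c y.

Definition primH (c : R -> R) (x : R) : R :=
  \int[mu]_(y in `]0, x]) (c y * ln (c y)).

Definition primGinv (c : R -> R) : R -> R :=
  'pinv_(fun=> 0) `]0, +oo[ (primG c).

End real_functions.

(* Main.v *)
Require Import Defs.
From HB Require Import structures.
From mathcomp Require Import all_boot all_order all_algebra.
From mathcomp Require Import all_classical all_reals all_analysis.
From mathcomp Require Import measurable_realfun ring lra.

Set Implicit Arguments.
Unset Strict Implicit.
Unset Printing Implicit Defensive.

Import Order.TTheory GRing.Theory Num.Theory.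
Import numFieldNormedType.Exports.

Local Open Scope classical_set_scope.
Local Open Scope ring_scope.

(* With [g = G(f)] and [Phi = H \o G^-1], one has [Phi' = ln c \o G^-1] and
   [Phi'' = (c'/c^2) \o G^-1], so [c'(f) |grad f|^2 = Phi''(g) |grad g|^2] and the
   claim is the entropy inequality
     [E Phi(g) - Phi(E g) <= 1/2 E (Phi''(g) |grad g|^2)].
   Concavity of [c/c'] amounts to concavity of [1/Phi''], whose derivative is
   formally [1 + (c/c')']. It makes [(u, v) |-> Phi''(u) v^2], hence the Bregman
   divergence [D] of [Phi], jointly convex, and the entropy
   [E Phi(g) - Phi(E g) = E D(g, E g)] subadditive over product measures. This
   reduces the inequality to dimension one. There a standard normal variable is
   split dyadically into independent [N(0, 2^-k)] increments, which bounds the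
   entropy by [2^k E D(g(X + Y), g(X))] with [X] and [Y] independent normal
   variables of variances [1 - 2^-k] and [2^-k]; as [k] tends to infinity the
   bound tends to [1/2 E (Phi''(g) g'^2)]. *)

(** Two obstacles shape the argument. First, [c / c'] is concave but need not be differentiable, so
    concavity of [1 / Phi''] cannot be read off a derivative: it is obtained by comparing chords,
    with [G] as the variable. Likewise [Phi''] is only known to be continuous, and joint convexity
    of [D] comes from a second-order Taylor formula along segments, without a third derivative.
    Second, [H \o G^-1] is regular only inside the range of [G] on the positive reals. As [f] is
    bounded and bounded away from 0, [G(f)] stays in a compact part of that range; every estimate is
    therefore stated for values in [[a, b]] with [lo < a] and [b < hi], a constraint that survives
    averaging.

    The factor [2^k] comes from splitting an increment into two independent halves: its entropy is
    at most twice that of one half. An increment of variance [2^-k] has entropy of order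
    [2^-k / 2 * Phi''(g) * g'^2], so the doublings are exactly compensated, and the constant 1/2 is
    a Taylor coefficient times the second moment of the standard normal law. *)

Section calculus.
Context {R : realType}.
Implicit Types (f g : R -> R).

Lemma is_derive1_continuous f (x df : R) :
  is_derive x 1 f df -> {for x, continuous f}.
Proof.
by move=> h; apply: differentiable_continuous; apply/derivable1_diffP.
Qed.

Lemma MVT_is_derive f df (a b : R) : a < b ->
  (forall x : R, a <= x <= b -> is_derive x 1 f (df x)) ->
  exists2 c, a < c < b & f b - f a = df c * (b - a).
Proof.
move=> ab h; have [x xab|x|c cab ->] := @MVT _ f df a b ab.
- by apply: h; rewrite !ltW ?(itvP xab).
- by apply: derivable_within_continuous => y; rewrite in_itv => /= /h [].
by exists c => //; move: cab; rewrite in_itv.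
Qed.

(** The Caratheodory slope [g] is continuous at [a] and nonpositive just to the right of it, hence
    nonpositive at [a]. One-sidedness matters: convexity inequalities only speak of weights in
    [[0, 1]]. *)
Lemma derive_le0_at_right f (a b df : R) : a < b -> is_derive a 1 f df ->
  (forall x, a <= x <= b -> f x <= f a) -> df <= 0.
Proof.
move=> ab /is_derive1_caratheodory[g [fg cg <-]] fa.
have : g x @[x --> a^'+] --> g a by apply: cvg_at_right_filter.
move=> /cvgr_to_le; apply; near=> x.
have ax : a < x by near: x; exact: nbhs_right_gt.
have xb : x <= b by near: x; exact: nbhs_right_le.
have : g x * (x - a) <= 0 by rewrite -fg subr_le0 fa// (ltW ax).
by rewrite pmulr_lle0// subr_gt0.
Unshelve. all: by end_near. Qed.

Lemma taylor2_01 f f1 f2 :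
  (forall t : R, 0 <= t <= 1 -> is_derive t 1 f (f1 t)) ->
  (forall t : R, 0 <= t <= 1 -> is_derive t 1 f1 (f2 t)) ->
  exists2 t, 0 <= t <= 1 & f 1 = f 0 + f1 0 + f2 t / 2.
Proof.
(* [K] is the value that makes [g 0 = g 1]. Since also [g1 0 = 0], the mean value theorem for [g],
   then for [g1] on [[0, t]], yields [f2 r = 2 K]. *)
move=> df df1; pose K := f 1 - f 0 - f1 0.
pose g (t : R) : R := f t - t * f1 0 - K * t ^+ 2.
pose g1 (t : R) : R := f1 t - f1 0 - K * (2 * t).
have dg (t : R) : 0 <= t <= 1 -> is_derive t 1 g (g1 t).
  move=> /df ?; rewrite /g; apply: is_derive_eq.
  by rewrite /g1 /= /GRing.scale /=; ring.
have dg1 (t : R) : 0 <= t <= 1 -> is_derive t 1 g1 (f2 t - K * 2).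
  move=> /df1 ?; rewrite /g1; apply: is_derive_eq.
  by rewrite /= /GRing.scale /=; ring.
have [t /andP[t0 t1] e1] := MVT_is_derive ltr01 dg.
have {}e1 : g1 t = 0 by move: e1; rewrite /g /K; lra.
have [|r /andP[r0 rt]] := @MVT_is_derive g1 (fun t => f2 t - K * 2) _ _ t0.
  by move=> x /andP[x0 xt]; apply: dg1; lra.
rewrite e1 {1}/g1 => e2; exists r; first lra.
have /eqP : (f2 r - K * 2) * t = 0 by lra.
by rewrite mulf_eq0 (gt_eqF t0) orbF => /eqP; rewrite /K; lra.
Qed.

Lemma continuous_bounded_segment f (lo hi a b : R) : lo < a -> b < hi ->
  (forall u : R, lo < u < hi -> {for u, continuous f}) ->
  exists K, forall u, a <= u <= b -> `|f u| <= K.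
Proof.
move=> loa bhi cf; have [ab|ba] := leP a b; last first.
  by exists 0 => u /andP[au ub]; have := le_trans au ub; rewrite leNgt ba.
have cab : {within `[a, b], continuous (fun u => `|f u|)}.
  apply: continuous_in_subspaceT => u; rewrite inE /= in_itv /= => /andP[au ub].
  apply: (@continuous_comp _ _ _ f (fun r : R => `|r|)).
    by apply: cf; lra.
  exact: norm_continuous.
have [c _ hc] := EVT_max ab cab.
by exists `|f c| => u uab; apply: hc; rewrite in_itv.
Qed.

(** [v ^+ 2 / p] is the perspective of the square, hence jointly convex; the gap is an explicit
    square in [v * q - w * p]. Letting [r] exceed the mean of [p] and [q] makes room for a concave
    function evaluated at a mean, here [1 / Phi2]. *)
Lemma sqr_over_convex (v w p q r s : R) : 0 < p -> 0 < q -> 0 <= s <= 1 ->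
  (1 - s) * p + s * q <= r ->
  ((1 - s) * v + s * w) ^+ 2 / r <= (1 - s) * (v ^+ 2 / p) + s * (w ^+ 2 / q).
Proof.
move=> p0 q0 /andP[s0 s1] hr.
have m0 : 0 < (1 - s) * p + s * q.
  have [->|sn0] := eqVneq s 0; first by rewrite subr0 mul1r mul0r addr0.
  have s0' : 0 < s by rewrite lt_neqAle eq_sym sn0.
  by rewrite ltr_wpDl// ?mulr_gt0// mulr_ge0 ?subr_ge0// ltW.
have r0 := lt_le_trans m0 hr.
rewrite ler_pdivrMr//.
set A := (1 - s) * _ + s * (_ / q).
have A0 : 0 <= A by rewrite addr_ge0// mulr_ge0 ?subr_ge0// divr_ge0 ?sqr_ge0 ?(ltW p0) ?(ltW q0).
apply: (@le_trans _ _ (A * ((1 - s) * p + s * q))); last exact: ler_wpM2l.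
rewrite -subr_ge0.
have -> : A * ((1 - s) * p + s * q) - ((1 - s) * v + s * w) ^+ 2 =
  (1 - s) * s * (v * q - w * p) ^+ 2 / (p * q).
  by rewrite /A; field; rewrite !gt_eqF.
apply: divr_ge0; last by rewrite ltW ?mulr_gt0.
by apply: mulr_ge0; [apply: mulr_ge0; lra|exact: sqr_ge0].
Qed.

End calculus.

(** * Joint convexity of the Bregman divergence *)

Section bregman.
Context {R : realType}.
Variables (lo hi : R) (Phi Phi1 Phi2 : R -> R).

(** This is the Latala-Oleszkiewicz condition on an entropy function, localized to []lo, hi[]; the
    last clause is concavity of [1 / Phi2] in chord form. *)
Definition admissible_phi : Prop :=
  [/\ (forall u : R, lo < u < hi -> is_derive u 1 Phi (Phi1 u)),
      (forall u : R, lo < u < hi -> is_derive u 1 Phi1 (Phi2 u)),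
      (forall u : R, lo < u < hi -> {for u, continuous Phi2}),
      (forall u : R, lo < u < hi -> 0 < Phi2 u) &
      (forall u v s : R, lo < u < hi -> lo < v < hi -> 0 <= s <= 1 ->
        (1 - s) * (Phi2 u)^-1 + s * (Phi2 v)^-1 <=
        (Phi2 ((1 - s) * u + s * v))^-1)].

Hypothesis adm : admissible_phi.

Definition bregman (u v : R) : R := Phi u - Phi v - Phi1 v * (u - v).

Let itv_conv (u v t : R) : lo < u < hi -> lo < v < hi -> 0 <= t <= 1 ->
  lo < (1 - t) * u + t * v < hi.
Proof.
move=> /andP[? ?] /andP[? ?] /andP[t0 t1].
have [->|t_neq1] := eqVneq t 1; first by rewrite subrr mul0r add0r mul1r; lra.
have {t_neq1}t1 : t < 1 by rewrite lt_neqAle t_neq1.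
by apply/andP; split; nra.
Qed.

Let itv_seg (u v t : R) : lo < u < hi -> lo < v < hi -> 0 <= t <= 1 ->
  lo < v + t * (u - v) < hi.
Proof.
move=> hu hv ht; have := itv_conv hv hu ht.
by rewrite (_ : (1 - t) * v + t * u = v + t * (u - v))//; ring.
Qed.

Let is_derive_seg (f : R -> R) (df v w t : R) :
  is_derive (v + t * w) 1 f df ->
  is_derive t 1 (fun t => f (v + t * w)) (df * w).
Proof.
move=> h; have hg : is_derive t 1 (fun t : R => v + t * w) w.
  by apply: is_derive_eq; rewrite /= /GRing.scale /=; ring.
exact: (@is_derive1_comp R f (fun t : R => v + t * w) t df w h hg).
Qed.

Lemma bregman_taylor (u v : R) : lo < u < hi -> lo < v < hi ->
  exists2 t, 0 <= t <= 1 &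
    bregman u v = Phi2 (v + t * (u - v)) * (u - v) ^+ 2 / 2.
Proof.
move=> hu hv; case: adm => dPhi dPhi1 _ _ _.
have [t|t|t t01] := @taylor2_01 R (fun t => Phi (v + t * (u - v)))
  (fun t => Phi1 (v + t * (u - v)) * (u - v))
  (fun t => Phi2 (v + t * (u - v)) * (u - v) * (u - v)).
- by move=> t01; apply: is_derive_seg; apply: dPhi; exact: itv_seg.
- move=> t01; have := is_derive_seg (dPhi1 _ (itv_seg hu hv t01)).
  by move=> h; apply: is_derive_eq; rewrite /= /GRing.scale /=; ring.
rewrite mul1r subrKC mul0r addr0 => e.
by exists t => //; rewrite /bregman e; ring.
Qed.

Lemma bregman_ge0 (u v : R) : lo < u < hi -> lo < v < hi -> 0 <= bregman u v.
Proof.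
move=> hu hv; have [t t01 ->] := bregman_taylor hu hv.
case: adm => _ _ _ Phi2_gt0 _.
by rewrite divr_ge0// mulr_ge0 ?sqr_ge0// ltW// Phi2_gt0// itv_seg.
Qed.

(* Along [v + t (u - v)] the second derivative of the Bregman divergence is
   [Phi'' * (u - v)^2], jointly convex since [1 / Phi''] is concave. *)
Lemma bregman_convex (u0 v0 u1 v1 s : R) :
  lo < u0 < hi -> lo < v0 < hi -> lo < u1 < hi -> lo < v1 < hi -> 0 <= s <= 1 ->
  bregman ((1 - s) * u0 + s * u1) ((1 - s) * v0 + s * v1) <=
  (1 - s) * bregman u0 v0 + s * bregman u1 v1.
Proof.
move=> hu0 hv0 hu1 hv1 hs; case: (adm) => dPhi dPhi1 _ Phi2_gt0 Phi2_conc.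
set u := (1 - s) * u0 + s * u1; set v := (1 - s) * v0 + s * v1.
have hu : lo < u < hi by exact: itv_conv.
have hv : lo < v < hi by exact: itv_conv.
(* Arranged so that [D0 u v 1 - D0 u v 0] is [bregman u v] and [D1 u v 0 = 0]: the Taylor formula
   then leaves only the second-order term. *)
pose D0 (u v t : R) := Phi (v + t * (u - v)) - t * (Phi1 v * (u - v)).
pose D1 (u v t : R) := Phi1 (v + t * (u - v)) * (u - v) - Phi1 v * (u - v).
pose D2 (u v t : R) := Phi2 (v + t * (u - v)) * (u - v) * (u - v).
have dD0 (a b t : R) : lo < a < hi -> lo < b < hi -> 0 <= t <= 1 ->
    is_derive t 1 (D0 a b) (D1 a b t).
  move=> ha hb ht; have := is_derive_seg (dPhi _ (itv_seg ha hb ht)).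
  move=> h; rewrite /D0; apply: is_derive_eq.
  by rewrite /D1 /= /GRing.scale /=; ring.
have dD1 (a b t : R) : lo < a < hi -> lo < b < hi -> 0 <= t <= 1 ->
    is_derive t 1 (D1 a b) (D2 a b t).
  move=> ha hb ht; have := is_derive_seg (dPhi1 _ (itv_seg ha hb ht)).
  move=> h; rewrite /D1; apply: is_derive_eq.
  by rewrite /D2 /= /GRing.scale /=; ring.
(* Taylor is applied to the whole combination rather than to each divergence, so that one and the
   same [t] occurs in the three terms. The three intermediate points are then in the affine relation
   that concavity of [1 / Phi2] requires. *)
pose comb (D : R -> R -> R -> R) t :=
  (1 - s) * D u0 v0 t + s * D u1 v1 t - D u v t.
have [t|t|t t01] := @taylor2_01 R (comb D0) (comb D1) (comb D2).
- move=> ht; have ? := dD0 _ _ _ hu0 hv0 ht; have ? := dD0 _ _ _ hu1 hv1 ht.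
  have ? := dD0 _ _ _ hu hv ht; rewrite /comb; apply: is_derive_eq.
  by rewrite /= /GRing.scale /=; ring.
- move=> ht; have ? := dD1 _ _ _ hu0 hv0 ht; have ? := dD1 _ _ _ hu1 hv1 ht.
  have ? := dD1 _ _ _ hu hv ht; rewrite /comb; apply: is_derive_eq.
  by rewrite /= /GRing.scale /=; ring.
have : 0 <= comb D2 t.
  rewrite /comb subr_ge0 /D2.
  have := @sqr_over_convex R (u0 - v0) (u1 - v1) (Phi2 (v0 + t * (u0 - v0)))^-1
    (Phi2 (v1 + t * (u1 - v1)))^-1 (Phi2 (v + t * (u - v)))^-1 s.
  rewrite !invr_gt0 !Phi2_gt0 ?itv_seg// hs => /(_ isT isT isT).
  have e (a b : R) : b ^+ 2 / a^-1 = a * b * b by rewrite invrK; ring.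
  rewrite !e.
  rewrite (_ : (1 - s) * (u0 - v0) + s * (u1 - v1) = u - v); last first.
    by rewrite /u /v; ring.
  apply; rewrite (_ : v + _ = (1 - s) * (v0 + t * (u0 - v0)) +
    s * (v1 + t * (u1 - v1))); last by rewrite /u /v; ring.
  by apply: Phi2_conc => //; exact: itv_seg.
move=> c2 e; rewrite -subr_ge0.
suff -> : (1 - s) * bregman u0 v0 + s * bregman u1 v1 - bregman u v =
    comb D2 t / 2 by rewrite divr_ge0.
move: e; rewrite /bregman /comb /D0 /D1 !mul0r !addr0 !mul1r !subrKC; lra.
Qed.

(** A convex function lies above its tangent plane: the partial derivatives of the divergence at
    [(u0, v0)] are [Phi1 u0 - Phi1 v0] and [- Phi2 v0 * (u0 - v0)]. *)
Lemma bregman_tangent (u0 v0 u v : R) :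
  lo < u0 < hi -> lo < v0 < hi -> lo < u < hi -> lo < v < hi ->
  bregman u0 v0 + (Phi1 u0 - Phi1 v0) * (u - u0) -
    Phi2 v0 * (u0 - v0) * (v - v0) <= bregman u v.
Proof.
move=> hu0 hv0 hu hv; case: (adm) => dPhi dPhi1 _ _ _.
pose K s := bregman (u0 + s * (u - u0)) (v0 + s * (v - v0)) -
  s * (bregman u v - bregman u0 v0).
have h a b : a + 0 * (b - a) = a :> R by rewrite mul0r addr0.
have du : is_derive (0 : R) 1 (fun s => Phi (u0 + s * (u - u0)))
    (Phi1 u0 * (u - u0)) by apply: is_derive_seg; rewrite h; exact: dPhi.
have dv : is_derive (0 : R) 1 (fun s => Phi (v0 + s * (v - v0)))
    (Phi1 v0 * (v - v0)) by apply: is_derive_seg; rewrite h; exact: dPhi.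
have dv1 : is_derive (0 : R) 1 (fun s => Phi1 (v0 + s * (v - v0)))
    (Phi2 v0 * (v - v0)) by apply: is_derive_seg; rewrite h; exact: dPhi1.
have dK : is_derive (0 : R) 1 K ((Phi1 u0 - Phi1 v0) * (u - u0) -
    Phi2 v0 * (u0 - v0) * (v - v0) - (bregman u v - bregman u0 v0)).
  rewrite /K; apply: is_derive_eq.
  by rewrite /= /GRing.scale /= !h; ring.
have : (Phi1 u0 - Phi1 v0) * (u - u0) -
    Phi2 v0 * (u0 - v0) * (v - v0) - (bregman u v - bregman u0 v0) <= 0.
  apply: (derive_le0_at_right ltr01 dK) => s hs.
  have := bregman_convex hu0 hv0 hu hv hs.
  have e a b : (1 - s) * a + s * b = a + s * (b - a) by ring.
  rewrite /K !h !e mul0r; lra.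
lra.
Qed.

End bregman.

(** * Integrals of bounded measurable functions against probabilities *)

Section bounded_measurable.
Context {R : realType}.

(** Almost every integrand below is of this kind, a class closed under products and partial
    integration, for which integrability and Fubini are automatic. *)
Definition bounded_mfun d (T : measurableType d) (f : T -> R) : Prop :=
  measurable_fun [set: T] f /\ exists M, forall x, `|f x| <= M.

Section one_space.
Context d (T : measurableType d).
Implicit Types (f g : T -> R).

Lemma bmfun_cst (r : R) : bounded_mfun (fun _ : T => r).
Proof. by split; [exact: measurable_cst|exists `|r|]. Qed.

Lemma bmfunD f g : bounded_mfun f -> bounded_mfun g ->
  bounded_mfun (fun x => f x + g x).
Proof.
move=> [mf [M fM]] [mg [N gN]]; split; first exact: measurable_funD.
by exists (M + N) => x; rewrite (le_trans (ler_normD _ _))// lerD.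
Qed.

Lemma bmfunB f g : bounded_mfun f -> bounded_mfun g ->
  bounded_mfun (fun x => f x - g x).
Proof.
move=> [mf [M fM]] [mg [N gN]]; split; first exact: measurable_funB.
by exists (M + N) => x; rewrite (le_trans (ler_normB _ _))// lerD.
Qed.

Lemma bmfunM f g : bounded_mfun f -> bounded_mfun g ->
  bounded_mfun (fun x => f x * g x).
Proof.
move=> [mf [M fM]] [mg [N gN]]; split; first exact: measurable_funM.
by exists (M * N) => x; rewrite normrM ler_pM.
Qed.

Lemma bmfun_sum n (F : 'I_n -> T -> R) : (forall i, bounded_mfun (F i)) ->
  bounded_mfun (fun x => \sum_(i < n) F i x).
Proof.
elim: n F => [|n IHn] F bF.
  by under eq_fun do rewrite big_ord0; exact: bmfun_cst.
by under eq_fun do rewrite big_ord_recl; apply: bmfunD => //; exact: IHn.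
Qed.

Lemma bmfun_integrable (P : probability T R) f : bounded_mfun f ->
  P.-integrable [set: T] (EFin \o f).
Proof.
move=> [mf [M fM]]; apply: measurable_bounded_integrable => //.
  by rewrite -ge0_fin_numE//; exact: fin_num_measure.
exists M; split; first by rewrite num_real.
by move=> x Mx y _ /=; rewrite (le_trans (fM y))// ltW.
Qed.

(** [phi] is controlled only on []lo, hi[]: openness of this interval gives measurability there, and
    compactness of [[a, b]] inside it gives the bound. *)
Lemma bmfun_comp_continuous f (phi : R -> R) (lo hi a b : R) :
  lo < a -> b < hi -> (forall x, a <= f x <= b) -> measurable_fun [set: T] f ->
  (forall u, lo < u < hi -> {for u, continuous phi}) ->
  bounded_mfun (fun x => phi (f x)).
Proof.
move=> loa bhi fab mf cphi; split.
  apply: (@measurable_comp _ _ _ _ _ _ `]lo, hi[%classic phi) => //.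
  - by move=> _ [x _ <-] /=; rewrite in_itv /=; have := fab x; lra.
  - apply: open_continuous_measurable_fun => // u.
    by rewrite inE /= in_itv /=; exact: cphi.
have [K hK] := continuous_bounded_segment loa bhi cphi.
by exists K => x; exact: hK.
Qed.

Lemma Rintegral_prob_cst (P : probability T R) (r : R) : \int[P]_x r = r.
Proof. by rewrite Rintegral_cst//= probability_setT mulr1. Qed.

Lemma Rintegral_bounds (P : probability T R) f (a b : R) :
  measurable_fun [set: T] f -> (forall x, a <= f x <= b) ->
  a <= \int[P]_x f x <= b.
Proof.
move=> mf fab.
have bf : bounded_mfun f.
  split=> //; exists (`|a| + `|b|) => x; have := fab x.
  by move=> /andP[? ?]; rewrite ler_norml; apply/andP; split;
    have := ler_norm (- a); have := ler_norm b; have := normr_ge0 a;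
    have := normr_ge0 b; rewrite normrN; lra.
rewrite -{1}(Rintegral_prob_cst P a) -{1}(Rintegral_prob_cst P b).
by apply/andP; split; apply: le_Rintegral => //;
  try exact: bmfun_integrable; try (apply: bmfun_integrable; exact: bmfun_cst);
  move=> x _; case/andP: (fab x).
Qed.

End one_space.

Lemma bmfun_comp d1 d2 (T1 : measurableType d1) (T2 : measurableType d2)
    (f : T2 -> R) (phi : T1 -> T2) :
  measurable_fun [set: T1] phi -> bounded_mfun f ->
  bounded_mfun (fun x => f (phi x)).
Proof.
move=> mphi [mf [M fM]]; split; first exact: measurableT_comp.
by exists M => x.
Qed.

Section two_spaces.
Context d1 d2 (T1 : measurableType d1) (T2 : measurableType d2).
Variables (P1 : probability T1 R) (P2 : probability T2 R).
Implicit Type F : T1 * T2 -> R.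

Lemma bmfun_pair1 F x : bounded_mfun F -> bounded_mfun (fun y => F (x, y)).
Proof. by apply: bmfun_comp; exact: pair1_measurable. Qed.

Lemma bmfun_pair2 F y : bounded_mfun F -> bounded_mfun (fun x => F (x, y)).
Proof. by apply: bmfun_comp; exact: pair2_measurable. Qed.

Lemma bmfun_Rintegral2 F : bounded_mfun F ->
  bounded_mfun (fun x => \int[P2]_y F (x, y)).
Proof.
move=> bF; have [mF [M FM]] := bF; split; last first.
  exists M => x; rewrite ler_norml.
  by apply: Rintegral_bounds => [|y]; [case: (bmfun_pair1 x bF)|rewrite -ler_norml].
apply: (@measurableT_comp _ _ _ _ _ _ (@fine R)) => //.
exact: (measurable_fubini_F (@bmfun_integrable _ _ (P1 \x P2)%E _ bF)).
Qed.

Lemma bmfun_Rintegral1 F : bounded_mfun F ->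
  bounded_mfun (fun y => \int[P1]_x F (x, y)).
Proof.
move=> bF; have [mF [M FM]] := bF; split; last first.
  exists M => y; rewrite ler_norml.
  by apply: Rintegral_bounds => [|x]; [case: (bmfun_pair2 y bF)|rewrite -ler_norml].
apply: (@measurableT_comp _ _ _ _ _ _ (@fine R)) => //.
exact: (measurable_fubini_G (@bmfun_integrable _ _ (P1 \x P2)%E _ bF)).
Qed.

Lemma Rintegral_prod12 F : bounded_mfun F ->
  \int[(P1 \x P2)%E]_z F z = \int[P1]_x \int[P2]_y F (x, y).
Proof.
move=> bF; rewrite /Rintegral -integral12_prod_meas1; last exact: bmfun_integrable.
congr fine; apply: eq_integral => x _; rewrite fineK//.
by apply: integrable_fin_num => //; apply: bmfun_integrable; exact: bmfun_pair1.
Qed.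

Lemma Rintegral_prod21 F : bounded_mfun F ->
  \int[(P1 \x P2)%E]_z F z = \int[P2]_y \int[P1]_x F (x, y).
Proof.
move=> bF; rewrite /Rintegral -integral21_prod_meas1; last exact: bmfun_integrable.
congr fine; apply: eq_integral => y _; rewrite fineK//.
by apply: integrable_fin_num => //; apply: bmfun_integrable; exact: bmfun_pair2.
Qed.

End two_spaces.
End bounded_measurable.

(** * Subadditivity of the entropy *)

Section subadditivity.
Context {R : realType} (lo hi a b : R) (Phi Phi1 Phi2 : R -> R).
Hypothesis adm : admissible_phi lo hi Phi Phi1 Phi2.
Hypotheses (loa : lo < a) (bhi : b < hi).

Let inside (x : R) : a <= x <= b -> lo < x < hi.
Proof. by move=> /andP[? ?]; move: loa bhi => ? ?; lra. Qed.

Let Phi_continuous (u : R) : lo < u < hi -> {for u, continuous Phi}.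
Proof. by case: adm => h _ _ _ _ /h; exact: is_derive1_continuous. Qed.

Let Phi1_continuous (u : R) : lo < u < hi -> {for u, continuous Phi1}.
Proof. by case: adm => _ h _ _ _ /h; exact: is_derive1_continuous. Qed.

Lemma bmfun_phi d (T : measurableType d) (f : T -> R) :
  measurable_fun [set: T] f -> (forall x, a <= f x <= b) ->
  bounded_mfun (fun x => Phi (f x)).
Proof. by move=> mf fab; exact: (bmfun_comp_continuous loa bhi). Qed.

Lemma bmfun_phi1 d (T : measurableType d) (f : T -> R) :
  measurable_fun [set: T] f -> (forall x, a <= f x <= b) ->
  bounded_mfun (fun x => Phi1 (f x)).
Proof. by move=> mf fab; exact: (bmfun_comp_continuous loa bhi). Qed.

Lemma bmfun_bounds d (T : measurableType d) (f : T -> R) :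
  measurable_fun [set: T] f -> (forall x, a <= f x <= b) -> bounded_mfun f.
Proof.
move=> mf fab; apply: (bmfun_comp_continuous loa bhi (phi := id)) => // u _.
exact: cvg_id.
Qed.

(** The right side exceeds the left by exactly the divergence of the mean of [f] from [c]: the mean
    is the best constant approximation for a Bregman divergence. *)
Lemma bregman_mean d (T : measurableType d) (P : probability T R)
    (f : T -> R) (c : R) :
  measurable_fun [set: T] f -> (forall x, a <= f x <= b) -> a <= c <= b ->
  \int[P]_x Phi (f x) - Phi (\int[P]_x f x) <= \int[P]_x bregman Phi Phi1 (f x) c.
Proof.
move=> mf fab cab; have mab := Rintegral_bounds P mf fab.
have bf := bmfun_bounds mf fab; have bPf := bmfun_phi mf fab.
have bc (r : R) : bounded_mfun (fun _ : T => r) by exact: bmfun_cst.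
have -> : \int[P]_x bregman Phi Phi1 (f x) c =
    \int[P]_x Phi (f x) - Phi c - Phi1 c * (\int[P]_x f x - c).
  rewrite [LHS]RintegralB//; first 1 last.
  - by apply: bmfun_integrable; exact: bmfunB.
  - by apply: bmfun_integrable; apply: bmfunM => //; exact: bmfunB.
  rewrite RintegralB//; [|exact: bmfun_integrable..].
  rewrite RintegralZl//; last by apply: bmfun_integrable; exact: bmfunB.
  by rewrite RintegralB//; [rewrite !Rintegral_prob_cst|exact: bmfun_integrable..].
have hm := inside mab; have hc := inside cab.
by have := bregman_ge0 adm hm hc; rewrite /bregman; lra.
Qed.

Context d1 d2 (T1 : measurableType d1) (T2 : measurableType d2).
Variables (P1 : probability T1 R) (P2 : probability T2 R).

(** Rearranged, the entropy of [g] is at most the sum of the averaged entropies in each variable.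
    The proof integrates [bregman_tangent] taken at [(w y, m)] and evaluated at [(g, v x)], where
    [v], [w], [m] are the two partial means and the full mean. *)
Lemma phi_subadditive (g : T1 * T2 -> R) :
  measurable_fun [set: T1 * T2] g -> (forall z, a <= g z <= b) ->
  \int[P1]_x Phi (\int[P2]_y g (x, y)) + \int[P2]_y Phi (\int[P1]_x g (x, y)) <=
  \int[(P1 \x P2)%E]_z Phi (g z) + Phi (\int[(P1 \x P2)%E]_z g z).
Proof.
move=> mg gab; have bg := bmfun_bounds mg gab.
pose P := (P1 \x P2)%E.
pose v x := \int[P2]_y g (x, y); pose w y := \int[P1]_x g (x, y).
pose m := \int[P]_z g z.
have bv : bounded_mfun v by exact: bmfun_Rintegral2.
have bw : bounded_mfun w by exact: bmfun_Rintegral1.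
have vab x : a <= v x <= b by apply: Rintegral_bounds => //; case: (bmfun_pair1 x bg).
have wab y : a <= w y <= b by apply: Rintegral_bounds => //; case: (bmfun_pair2 y bg).
have mab : a <= m <= b by exact: Rintegral_bounds.
have b1 (f : T1 -> R) : bounded_mfun f -> bounded_mfun (fun z : T1 * T2 => f z.1).
  by apply: bmfun_comp; exact: measurable_fst.
have b2 (f : T2 -> R) : bounded_mfun f -> bounded_mfun (fun z : T1 * T2 => f z.2).
  by apply: bmfun_comp; exact: measurable_snd.
have bc d (T : measurableType d) (r : R) : bounded_mfun (fun _ : T => r).
  exact: bmfun_cst.
have bPg : bounded_mfun (fun z => Phi (g z)) by exact: bmfun_phi.
have bPv : bounded_mfun (fun x => Phi (v x)) by apply: bmfun_phi => //; case: bv.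
have bPw : bounded_mfun (fun x => Phi (w x)) by apply: bmfun_phi => //; case: bw.
have bP1v : bounded_mfun (fun x => Phi1 (v x)) by apply: bmfun_phi1 => //; case: bv.
have bP1w : bounded_mfun (fun x => Phi1 (w x)) by apply: bmfun_phi1 => //; case: bw.
(* [t1] to [t4] collect the first-order terms of the tangent inequality, all of integral zero: [t1]
   after integrating in the second variable, [t2] in the first, [t3] globally, and [t4] because
   [v - m] and [w - m] are independent and centered. *)
pose t1 z := Phi1 (v z.1) * (g z - v z.1).
pose t2 z := Phi1 (w z.2) * (g z - w z.2).
pose t3 z := Phi1 m * (g z - m).
pose t4 (z : T1 * T2) := Phi2 m * ((v z.1 - m) * (w z.2 - m)).
have bt1 : bounded_mfun t1 by apply: bmfunM; [exact: (b1 _ bP1v)|apply: bmfunB => //; exact: (b1 _ bv)].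
have bt2 : bounded_mfun t2 by apply: bmfunM; [exact: (b2 _ bP1w)|apply: bmfunB => //; exact: (b2 _ bw)].
have bt3 : bounded_mfun t3 by apply: bmfunM => //; exact: bmfunB.
have bvm : bounded_mfun (fun x => v x - m) by exact: bmfunB.
have bwm : bounded_mfun (fun x => w x - m) by exact: bmfunB.
have bt4 : bounded_mfun t4.
  by apply: bmfunM => //; apply: bmfunM; [exact: (b1 _ bvm)|exact: (b2 _ bwm)].
have I (f : T1 * T2 -> R) : bounded_mfun f -> P.-integrable setT (EFin \o f).
  by move=> bf; exact: bmfun_integrable.
have i1 : \int[P]_z t1 z = 0.
  rewrite Rintegral_prod12// -[RHS](Rintegral_prob_cst P1 0); apply: eq_Rintegral => x _.
  have bgx := bmfun_pair1 x bg; rewrite /t1 /=.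
  rewrite RintegralZl//; last by apply: bmfun_integrable; exact: bmfunB.
  rewrite RintegralB//; [|exact: bmfun_integrable..].
  by rewrite Rintegral_prob_cst subrr mulr0.
have i2 : \int[P]_z t2 z = 0.
  rewrite Rintegral_prod21// -[RHS](Rintegral_prob_cst P2 0); apply: eq_Rintegral => y _.
  have bgy := bmfun_pair2 y bg; rewrite /t2 /=.
  rewrite RintegralZl//; last by apply: bmfun_integrable; exact: bmfunB.
  rewrite RintegralB//; [|exact: bmfun_integrable..].
  by rewrite Rintegral_prob_cst subrr mulr0.
have i3 : \int[P]_z t3 z = 0.
  rewrite /t3 RintegralZl//; last by apply: I; exact: bmfunB.
  rewrite RintegralB//; [|exact: I..].
  by rewrite Rintegral_prob_cst subrr mulr0.
have i4 : \int[P]_z t4 z = 0.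
  rewrite Rintegral_prod12// -[RHS](Rintegral_prob_cst P1 0); apply: eq_Rintegral => x _.
  rewrite /t4 /= RintegralZl//; last by apply: bmfun_integrable; exact: bmfunM.
  rewrite RintegralZl//; last exact: bmfun_integrable.
  rewrite RintegralB//; [|exact: bmfun_integrable..].
  by rewrite Rintegral_prob_cst -Rintegral_prod21// subrr !mulr0.
pose L z := Phi (v z.1) + Phi (w z.2) + (t1 z + t2 z - t3 z - t4 z).
have bL : bounded_mfun L.
  by apply: bmfunD; [apply: bmfunD; [exact: (b1 _ bPv)|exact: (b2 _ bPw)]|
    apply: bmfunB => //; apply: bmfunB => //; exact: bmfunD].
have -> : \int[P1]_x Phi (v x) + \int[P2]_y Phi (w y) = \int[P]_z L z.
  rewrite RintegralD//; first last.
  - by apply: I; apply: bmfunB => //; apply: bmfunB => //; exact: bmfunD.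
  - by apply: I; apply: bmfunD; [exact: (b1 _ bPv)|exact: (b2 _ bPw)].
  rewrite RintegralD//; [|exact: (I _ (b1 _ bPv))|exact: (I _ (b2 _ bPw))].
  rewrite RintegralB//; [|by apply: I; apply: bmfunB => //; exact: bmfunD|exact: I].
  rewrite RintegralB//; [|by apply: I; exact: bmfunD|exact: I].
  rewrite RintegralD//; [|exact: I|exact: I].
  rewrite i1 i2 i3 i4 !(addr0, subr0).
  rewrite Rintegral_prod12; last exact: (b1 _ bPv).
  rewrite Rintegral_prod21; last exact: (b2 _ bPw).
  by congr (_ + _); apply: eq_Rintegral => z _; rewrite /= Rintegral_prob_cst.
rewrite -[Phi (\int[_]_z _)](Rintegral_prob_cst P) -RintegralD//; [|exact: I|exact: I].
apply: le_Rintegral => //; [exact: I|by apply: I; exact: bmfunD|].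
move=> z _.
have hgz := inside (gab z); have hvz := inside (vab z.1).
have hwz := inside (wab z.2); have hm := inside mab.
have := bregman_tangent adm hwz hm hgz hvz.
rewrite /bregman /L /t1 /t2 /t3 /t4 -/m; lra.
Qed.

End subadditivity.

(** * Gaussian integrals *)

Section density.
Local Open Scope ereal_scope.
Context {R : realType} d (T : measurableType d).
Variables (mu nu : {measure set T -> \bar R}) (p : T -> R).
Hypothesis p_ge0 : forall x, (0 <= p x)%R.
Hypothesis mp : measurable_fun [set: T] p.
Hypothesis nuE : forall A, measurable A -> nu A = \int[mu]_(x in A) (p x)%:E.

Let integral_density_indic E : measurable E ->
  \int[nu]_x (\1_E x)%:E = \int[mu]_x ((\1_E x)%:E * (p x)%:E).
Proof.
move=> mE; rewrite integral_indic//= setIT nuE// integral_mkcond.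
apply: eq_integral => x _; rewrite patchE indicE; case: ifPn => _.
  by rewrite mul1e.
by rewrite mul0e.
Qed.

Import HBNNSimple.

Let integral_density_nnsfun (f : {nnsfun T >-> R}) :
  \int[nu]_x (f x)%:E = \int[mu]_x ((f x)%:E * (p x)%:E).
Proof.
under [LHS]eq_integral do rewrite fimfunE -fsumEFin//.
rewrite [LHS]ge0_integral_fsum//; last 2 first.
  - by move=> r; exact/measurable_EFinP/measurableT_comp.
  - by move=> n x _; rewrite EFinM nnfun_muleindic_ge0.
under [RHS]eq_integral.
  move=> x xD; rewrite fimfunE -fsumEFin// muleC ge0_mule_fsumr; last first.
    by move=> r; rewrite EFinM nnfun_muleindic_ge0.
  over.
rewrite [RHS]ge0_integral_fsum//; last 2 first.
  - move=> r; apply: emeasurable_funM; first exact/measurable_EFinP.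
    by apply/measurable_EFinP; apply: measurable_funM.
  - move=> n x _; apply: mule_ge0; first by rewrite lee_fin.
    by rewrite EFinM nnfun_muleindic_ge0.
apply: eq_fsbigr => r /set_mem [t _ ft].
under [RHS]eq_integral do rewrite EFinM muleCA.
under eq_integral do rewrite EFinM.
have r0 : (0 <= r)%R by rewrite -ft.
rewrite ge0_integralZl//; last exact/measurable_EFinP/measurable_indic.
rewrite ge0_integralZl//; last 2 first.
- apply: emeasurable_funM; first exact/measurable_EFinP.
  exact/measurable_EFinP/measurable_indic.
- by move=> x _; rewrite mule_ge0 ?lee_fin.
rewrite integral_density_indic//; congr (_ * _).
by apply: eq_integral => x _; rewrite muleC.
Qed.

(** The density is given on sets only, so the formula climbs from indicators to simple functions,
    and then to [f] by monotone convergence on both sides. *)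
Lemma ge0_integral_density (f : T -> \bar R) :
  measurable_fun [set: T] f -> (forall x, 0 <= f x) ->
  \int[nu]_x f x = \int[mu]_x (f x * (p x)%:E).
Proof.
move=> mf f0; pose f_ := nnsfun_approx measurableT mf.
transitivity (lim (\int[nu]_x (f_ n x)%:E @[n --> \oo])).
  rewrite -monotone_convergence//=.
  - by apply: eq_integral => x _; apply/esym/cvg_lim => //=; exact: cvg_nnsfun_approx.
  - by move=> n; exact/measurable_EFinP/measurable_funTS.
  - by move=> n x _; rewrite lee_fin.
  - by move=> x _ m n mn; rewrite lee_fin; exact/lefP/nd_nnsfun_approx.
rewrite (_ : \int[mu]_x (f x * (p x)%:E) =
    lim (\int[mu]_x ((f_ n x)%:E * (p x)%:E) @[n --> \oo])); last first.
  rewrite -monotone_convergence//=.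
  - apply: eq_integral => x _; apply/esym/cvg_lim => //=.
    by apply: cvgeZr => //; exact: cvg_nnsfun_approx.
  - move=> n; apply: emeasurable_funM; exact/measurable_EFinP.
  - by move=> n x _; rewrite mule_ge0 ?lee_fin.
  - move=> x _ m n mn; rewrite lee_wpmul2r ?lee_fin//.
    exact/lefP/nd_nnsfun_approx.
by apply: congr_lim; apply/funext => n /=; exact: integral_density_nnsfun.
Qed.

End density.

Definition std_normal (R : realType) : probability (measurableTypeR R) R :=
  normal_prob 0 1.

Section gaussian.
Context {R : realType}.
Local Notation mu := (@lebesgue_measure R).
Local Notation gamma := (std_normal R).

Lemma ge0_integral_gaussian (f : R -> \bar R) :
  measurable_fun [set: R] f -> (forall x, 0 <= f x)%E ->
  (\int[gamma]_x f x = \int[mu]_x (f x * (normal_pdf 0 1 x)%:E))%E.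
Proof.
move=> mf f0; apply: ge0_integral_density => //.
- exact: normal_pdf_ge0.
- exact: measurable_normal_pdf.
Qed.

Lemma normal_pdf1E (x : R) :
  normal_pdf 0 1 x = (Num.sqrt (pi *+ 2))^-1 * expR (- x ^+ 2 / 2).
Proof.
rewrite normal_pdfE ?oner_neq0// /normal_peak /normal_fun.
by rewrite subr0 expr1n mul1r.
Qed.

Lemma normal_pdf_posE (m s x : R) : 0 < s ->
  normal_pdf m s x =
  (Num.sqrt (pi *+ 2))^-1 * s^-1 * expR (- (x - m) ^+ 2 / (2 * s ^+ 2)).
Proof.
move=> s0; rewrite normal_pdfE ?gt_eqF// /normal_peak /normal_fun.
rewrite -mulrnAr sqrtrM ?sqr_ge0// sqrtr_sqr gtr0_norm// invfM.
by rewrite [s^-1 * _]mulrC mulr_natl.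
Qed.

(** The weight tilts the standard normal density into [s] times the centered normal density of
    standard deviation [s = (1 + 2 r)^(-1/2)], whose mass is 1. *)
Lemma gaussian_expR_sqr (r : R) : - 2^-1 < r ->
  (\int[gamma]_x (expR (- (r * x ^+ 2)))%:E = (Num.sqrt (1 + 2 * r))^-1%:E)%E.
Proof.
move=> hr; have r1 : 0 < 1 + 2 * r by lra.
pose s := (Num.sqrt (1 + 2 * r))^-1.
have s0 : 0 < s by rewrite invr_gt0 sqrtr_gt0.
have mexp : measurable_fun [set: R] (fun x => (expR (- (r * x ^+ 2)))%:E).
  by apply/measurable_EFinP; apply: measurableT_comp => //;
    apply: measurableT_comp => //; apply: measurable_funM => //;
    exact: measurable_funX.
rewrite ge0_integral_gaussian//.
rewrite (eq_integral (fun x : measurableTypeR R => s%:E * (normal_pdf 0 s x)%:E)%E); last first.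
  move=> x _; rewrite -!EFinM normal_pdf1E normal_pdf_posE//; congr EFin.
  rewrite subr0 mulrCA -expRD [RHS]mulrA [s * _]mulrC divfK ?gt_eqF//.
  congr (_ * expR _).
  rewrite /s exprVn sqr_sqrtr ?ltW//; field; lra.
rewrite ge0_integralZl//; last 3 first.
- by apply/measurable_EFinP; exact: measurable_normal_pdf.
- by move=> x _; rewrite lee_fin normal_pdf_ge0.
- by rewrite lee_fin ltW.
by rewrite integral_normal_pdf mule1.
Qed.

(* Completing the square: [phi(x) phi((t - a x)/b)/b] is [phi(t)] times the
   density of the normal law with mean [a t] and standard deviation [b]. *)
Lemma ge0_gaussian_rotation (F : R -> R) (a b : R) : 0 < b ->
  a ^+ 2 + b ^+ 2 = 1 -> continuous F -> (forall x, 0 <= F x) ->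
  (\int[gamma]_x \int[gamma]_y (F (a * x + b * y))%:E =
   \int[gamma]_x (F x)%:E)%E.
Proof.
move=> b0 ab cF F0.
have mF : measurable_fun [set: R] F by exact: continuous_measurable_fun.
have mlin d' (T' : measurableType d') (f g : T' -> R) :
    measurable_fun [set: T'] f -> measurable_fun [set: T'] g ->
    measurable_fun [set: T'] (fun z => a * f z + b * g z).
  by move=> mf mg; apply: measurable_funD; apply: measurable_funM.
pose F2 (z : measurableTypeR R * measurableTypeR R) := (F (a * z.1 + b * z.2))%:E.
have mF2 : measurable_fun [set: measurableTypeR R * measurableTypeR R] F2.
  by apply/measurable_EFinP; apply: measurableT_comp => //; exact: mlin.
rewrite ge0_integral_gaussian; last 2 first.
- by apply: (measurable_fun_fubini_tonelli_F F2) => // z; rewrite lee_fin.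
- by move=> x; apply: integral_ge0 => y _; rewrite lee_fin.
pose K (z : measurableTypeR R * measurableTypeR R) : R :=
  F z.2 * (normal_pdf 0 1 z.2 * normal_pdf (a * z.2) b z.1).
have K0 z : 0 <= K z by rewrite !mulr_ge0 ?normal_pdf_ge0.
have key (x y : R) : K (x, a * x + b * y) * b =
    F (a * x + b * y) * normal_pdf 0 1 y * normal_pdf 0 1 x.
  rewrite /K /= (normal_pdf_posE _ _ b0) !normal_pdf1E; set c := (Num.sqrt _)^-1.
  rewrite -!mulrA; congr (_ * _).
  set e1 := expR _; set e2 := expR _; set e3 := expR _; set e4 := expR _.
  have e : e1 * e2 = e3 * e4.
    rewrite /e1 /e2 /e3 /e4 -!expRD; congr expR.
    have -> : x - a * (a * x + b * y) = b * (b * x - a * y).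
      have -> : a * (a * x + b * y) = a ^+ 2 * x + a * b * y by ring.
      have -> : a ^+ 2 = 1 - b ^+ 2 by lra.
      by ring.
    have -> : - (a * x + b * y) ^+ 2 / 2 + - (b * (b * x - a * y)) ^+ 2 / (2 * b ^+ 2) =
       - (a ^+ 2 + b ^+ 2) * (x ^+ 2 + y ^+ 2) / 2.
      by field; rewrite gt_eqF.
    by rewrite ab; ring.
  have -> : c * (e1 * (c * (b^-1 * (e2 * b)))) = c * c * (e1 * e2).
    by field; rewrite gt_eqF.
  by rewrite e; ring.
have sub (x : R) : (\int[gamma]_y (F (a * x + b * y))%:E * (normal_pdf 0 1 x)%:E =
    \int[mu]_t (K (x, t))%:E)%E.
  rewrite ge0_integral_gaussian; last 2 first.
  - by apply/measurable_EFinP; apply: measurableT_comp => //; exact: mlin.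
  - by move=> y; rewrite lee_fin.
  rewrite -ge0_integralZr//; last 3 first.
  - apply/measurable_EFinP; apply: measurable_funM.
      by apply: measurableT_comp => //; exact: mlin.
    exact: measurable_normal_pdf.
  - by move=> y _; rewrite mule_ge0 ?lee_fin// normal_pdf_ge0.
  - by rewrite lee_fin normal_pdf_ge0.
  (* The line [a x + b y], written as a shift followed by a positive scaling so that its limits at
     both infinities are those of these two operations. *)
  pose H (y : R) := (y + a * x / b) * b.
  have HE y : H y = a * x + b * y by rewrite /H; field; rewrite gt_eqF.
  have dH (y : R) : is_derive y 1 H b.
    by rewrite /H; apply: is_derive_eq; rewrite /= /GRing.scale /=; ring.
  have H'E : H^`()%classic = cst b.
    by apply/funext => y; rewrite derive1E; have [_ ->] := dH y.
  rewrite (@increasing_ge0_integration_by_substitutionT R H (fun t => K (x, t))).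
  - by apply: eq_integral => y _; rewrite H'E /= !fctE /= HE -!EFinM key.
  - by move=> y z yz; rewrite /H ltr_pM2r// ltrD2r.
  - by rewrite H'E => y; exact: cvg_cst.
  - by rewrite H'E; exact: is_cvg_cst.
  - by rewrite H'E; exact: is_cvg_cst.
  - by move=> y; case: (dH y).
  - by apply: gt0_cvgMlNy => //; exact: cvg_addrr_Ny.
  - by apply: gt0_cvgMly => //; exact: cvg_addrr.
  (* The density depends on [(x - a t)^2] only, so mean and argument may be exchanged: continuity in
     [t] becomes that of a normal density with the fixed mean [x]. *)
  - have -> : (fun t => K (x, t)) =
        (fun t => F t * (normal_pdf 0 1 t * normal_pdf x b (a * t))).
      by apply/funext => t; rewrite /K /= !(normal_pdf_posE _ _ b0) -(opprB x (a * t)) sqrrN.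
    move=> t; apply: cvgM; first exact: cF.
    apply: cvgM; first by apply: continuous_normal_pdf; rewrite oner_neq0.
    apply: (@continuous_comp _ _ _ (fun t => a * t) (normal_pdf x b)).
      by apply: cvgM; [exact: cvg_cst|exact: cvg_id].
    by apply: continuous_normal_pdf; rewrite gt_eqF.
  - by move=> t; exact: K0.
under eq_integral do rewrite sub.
have mK : measurable_fun setT (EFin \o K).
  apply/measurable_EFinP; apply: measurable_funM.
    exact: (measurableT_comp mF measurable_snd).
  apply: measurable_funM.
    exact: (measurableT_comp (measurable_normal_pdf 0 1) measurable_snd).
  under eq_fun do rewrite normal_pdf_posE//.
  apply: measurable_funM => //; apply: measurableT_comp => //.
  apply: measurable_funM => //; apply: measurableT_comp => //.
  apply: measurable_funX; apply: measurable_funB; first exact: measurable_fst.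
  by apply: measurable_funM => //; exact: measurable_snd.
rewrite (fubini_tonelli (EFin \o K))//=.
rewrite [RHS]ge0_integral_gaussian//; last exact/measurable_EFinP.
apply: eq_integral => t _.
under eq_integral do rewrite /K /= mulrA EFinM.
rewrite ge0_integralZl//; last 3 first.
- by apply/measurable_EFinP; exact: measurable_normal_pdf.
- by move=> x _; rewrite lee_fin normal_pdf_ge0.
- by rewrite lee_fin mulr_ge0 ?normal_pdf_ge0.
by rewrite integral_normal_pdf mule1 EFinM.
Qed.

Lemma bmfun_continuous (F : R -> R) : continuous F ->
  (exists M, forall x, `|F x| <= M) ->
  bounded_mfun (F : measurableTypeR R -> R).
Proof. by move=> cF FM; split => //; exact: continuous_measurable_fun. Qed.

Lemma gaussian_rotation (F : R -> R) (a b : R) : 0 < b ->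
  a ^+ 2 + b ^+ 2 = 1 -> continuous F -> (exists M, forall x, `|F x| <= M) ->
  \int[gamma]_x \int[gamma]_y F (a * x + b * y) = \int[gamma]_x F x.
Proof.
move=> b0 ab cF FM; have bF := bmfun_continuous cF FM.
have [M hM] := FM.
have b2 : bounded_mfun (fun z : measurableTypeR R * measurableTypeR R =>
    F (a * z.1 + b * z.2)).
  apply: (bmfun_comp (T2 := measurableTypeR R) (f := F)) => //.
  by apply: measurable_funD; apply: measurable_funM.
have bin (x : R) : bounded_mfun (fun y : measurableTypeR R => F (a * x + b * y)).
  exact: (bmfun_pair1 (x : measurableTypeR R) b2).
have bout : bounded_mfun (fun x : measurableTypeR R => \int[gamma]_y F (a * x + b * y)).
  exact: (bmfun_Rintegral2 gamma gamma b2).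
have bM : bounded_mfun (fun _ : measurableTypeR R => M) by exact: bmfun_cst.
(* Adding the bound [M] makes the integrand nonnegative; as the measures have mass 1, both sides
   increase by [M]. *)
have cFM : continuous (fun x => F x + M).
  by move=> x; apply: cvgD; [exact: cF|exact: cvg_cst].
have FM0 x : 0 <= F x + M.
  by have := hM x; rewrite ler_norml => /andP[h _]; lra.
have := congr1 fine (ge0_gaussian_rotation b0 ab cFM FM0).
rewrite -[X in _ = X]/(\int[gamma]_x (F x + M)) RintegralD//; last 2 first.
- exact: bmfun_integrable.
- exact: bmfun_integrable.
rewrite Rintegral_prob_cst => h; apply: (@addIr _ M); rewrite -h.
rewrite -{1}(Rintegral_prob_cst gamma M) -RintegralD//; last 2 first.
- exact: bmfun_integrable.
- exact: bmfun_integrable.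
congr fine; apply: eq_integral => x _.
rewrite -{1}(Rintegral_prob_cst gamma M) -RintegralD//; last 2 first.
- exact: bmfun_integrable.
- exact: bmfun_integrable.
rewrite /Rintegral fineK//; apply: integrable_fin_num => //.
by apply: bmfun_integrable; exact: bmfunD.
Qed.

Lemma gaussian_integrable_expR_sqr (r : R) : - 2^-1 < r ->
  gamma.-integrable [set: measurableTypeR R] (EFin \o (fun x => expR (- (r * x ^+ 2)))).
Proof.
move=> hr; apply/integrableP; split.
  by apply/measurable_EFinP; apply: measurableT_comp => //;
    apply: measurableT_comp => //; apply: measurable_funM => //;
    exact: measurable_funX.
under eq_integral do rewrite /= ger0_norm ?expR_ge0//.
by rewrite gaussian_expR_sqr// ltry.
Qed.

(** The constant 8 leaves a margin: even the product of two factors [expR (x ^+ 2 / 8)] is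
    integrable, since 1/4 < 1/2. *)
Lemma sqr_le_expR (x : R) : x ^+ 2 <= 8 * expR (x ^+ 2 / 8).
Proof. have := expR_ge1Dx (x ^+ 2 / 8); lra. Qed.

Lemma gaussian_integrable_sqr :
  gamma.-integrable [set: measurableTypeR R] (EFin \o (fun x => x ^+ 2)).
Proof.
have i : gamma.-integrable [set: measurableTypeR R]
   (fun x : measurableTypeR R => 8%:E * (expR (- (- 8^-1 * x ^+ 2)))%:E)%E.
  by apply: integrableZl => //; apply: gaussian_integrable_expR_sqr; lra.
apply: le_integrable i => //.
  by apply/measurable_EFinP; exact: measurable_funX.
move=> x _ /=; rewrite lee_fin (ger0_norm (sqr_ge0 x)).
rewrite ger0_norm; last by rewrite mulr_ge0 ?expR_ge0.
by rewrite mulNr opprK [8^-1 * _]mulrC sqr_le_expR.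
Qed.

(** Minus the derivative at 0 of [r |-> E expR (- (r * x ^+ 2))], known in closed form. For
    [|r| < 1/8] the differentiated integrand is dominated by [8 * expR (x ^+ 2 / 4)]. *)
Lemma gaussian_second_moment : \int[gamma]_x x ^+ 2 = 1.
Proof.
pose f (r : R) (x : measurableTypeR R) : R := expR (- (r * x ^+ 2)).
have df (r x : R) : is_derive r 1 (f^~ x) (- x ^+ 2 * expR (- (r * x ^+ 2))).
  rewrite /f; apply: is_derive_eq; rewrite /= /GRing.scale /=; ring.
pose G (x : measurableTypeR R) : R := 8 * expR (x ^+ 2 / 4).
have I0 : `](- 8^-1 : R), 8^-1[%classic 0 by rewrite /= in_itv /=; lra.
have intf (r : R) : `](- 8^-1), 8^-1[%classic r ->
    gamma.-integrable setT (EFin \o f r).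
  by rewrite /= in_itv /= => /andP[? ?]; apply: gaussian_integrable_expR_sqr; lra.
have derf (r : R) (x : measurableTypeR R) : `](- 8^-1), 8^-1[%classic r -> setT x ->
    derivable (f^~ x) r 1 by move=> _ _; case: (df r x).
have G0 y : 0 <= G y by rewrite mulr_ge0 ?expR_ge0.
have intG : gamma.-integrable setT (EFin \o G).
  rewrite (_ : _ \o _ = fun x : measurableTypeR R =>
      8%:E * (expR (- (- 4^-1 * x ^+ 2)))%:E)%E.
    by apply: integrableZl => //; apply: gaussian_integrable_expR_sqr; lra.
  by apply/funext => x; rewrite /G /= mulNr opprK [4^-1 * _]mulrC.
have Gub (r : R) (x : measurableTypeR R) : `](- 8^-1), 8^-1[%classic r -> setT x ->
    `|partial1of2 f r x| <= G x.
  rewrite /= in_itv /= => /andP[r1 r2] _.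
  rewrite partial1of2E; have [_ ->] := df r x.
  rewrite normrM normrN (ger0_norm (sqr_ge0 x)) (ger0_norm (expR_ge0 _)).
  apply: (@le_trans _ _ (8 * expR (x ^+ 2 / 8) * expR (x ^+ 2 / 8))).
    apply: ler_pM; rewrite ?sqr_ge0 ?expR_ge0 ?sqr_le_expR// ler_expR.
    by have := sqr_ge0 x; nra.
  by rewrite -mulrA -expRD /G ler_pM2l// ler_expR; lra.
pose F (r : R) := \int[gamma]_x f r x.
have FE (r : R) : `](- 8^-1), 8^-1[%classic r -> F r = (Num.sqrt (1 + 2 * r))^-1.
  rewrite /= in_itv /= => /andP[r1 r2].
  by rewrite /F /Rintegral gaussian_expR_sqr//; lra.
have e := @differentiation_under_integral R _ _ gamma f setT measurableT 0 _ _
  I0 intf derf G G0 intG Gub.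
have d := @derivable_under_integral R _ _ gamma f setT measurableT 0 _ _
  I0 intf derf G G0 intG Gub.
rewrite -/F in e d.
have F0 : F 0 = 1 by rewrite FE// mulr0 addr0 sqrtr1 invr1.
have dF : is_derive (0 : R) 1 F (F^`()%classic 0) by rewrite derive1E; exact: derivableP.
(* The closed form is used as [F r ^+ 2 * (1 + 2 * r) = 1] near 0; differentiating this identity
   gives [F' 0 = -1] without differentiating an inverse square root. *)
have dF2 : is_derive (0 : R) 1 (fun r => F r ^+ 2 * (1 + 2 * r))
    (2 * F^`()%classic 0 + 2).
  by apply: is_derive_eq; rewrite /= /GRing.scale /= F0; ring.
have F2near : {near (0 : R), (fun r => F r ^+ 2 * (1 + 2 * r)) =1 cst 1}.
  near=> r.
  have rI : `](- 8^-1), 8^-1[%classic r.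
    near: r; exact: near_in_itvoo.
  rewrite FE//; move: rI; rewrite /= in_itv /= => /andP[r1 r2].
  by rewrite exprVn sqr_sqrtr ?mulVf//; lra.
have : 2 * F^`()%classic 0 + 2 = 0.
  have [_ <-] := dF2.
  rewrite (near_eq_derive _ F2near)//.
  exact: derive_cst.
rewrite e => h.
have {h} -> : 1 = - \int[gamma]_y partial1of2 f 0 y by lra.
rewrite [in RHS](@eq_Rintegral _ _ _ _ _ (fun y : measurableTypeR R => -1 * (y : R) ^+ 2)); last first.
  move=> y _; rewrite partial1of2E; have [_ ->] := df 0 y.
  by rewrite mul0r oppr0 expR0 mulr1 mulN1r.
by rewrite RintegralZl ?mulN1r ?opprK//; exact: gaussian_integrable_sqr.
Unshelve. all: by end_near. Qed.

End gaussian.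

(** * The entropy inequality in dimension one *)

Section one_dimension.
Context {R : realType} (lo hi a b : R) (Phi Phi1 Phi2 : R -> R).
Hypothesis adm : admissible_phi lo hi Phi Phi1 Phi2.
Hypotheses (loa : lo < a) (bhi : b < hi).
Local Notation gamma := (std_normal R).

Variables (g g' : R -> R) (M : R).
Hypothesis dg : forall x : R, is_derive x 1 g (g' x).
Hypothesis cg' : continuous g'.
Hypothesis g'M : forall x, `|g' x| <= M.
Hypothesis gab : forall x, a <= g x <= b.

Let inside (x : R) : a <= x <= b -> lo < x < hi.
Proof. by move=> /andP[? ?]; move: loa bhi => ? ?; lra. Qed.

Let cg : continuous g.
Proof. by move=> x; exact: is_derive1_continuous (dg x). Qed.

Let ab : a <= b.
Proof. by have /andP[h1 h2] := gab 0; exact: le_trans h1 h2. Qed.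

Let cPhi (u : R) : lo < u < hi -> {for u, continuous Phi}.
Proof. by case: adm => h _ _ _ _ /h; exact: is_derive1_continuous. Qed.

Let cshift (p q : R) : continuous (fun x => g (p + q * x)).
Proof.
move=> x; apply: (@continuous_comp _ _ _ (fun x => p + q * x) g); last exact: cg.
by apply: cvgD; [exact: cvg_cst|apply: cvgM; [exact: cvg_cst|exact: cvg_id]].
Qed.

Let mlin (x p : R) :
  measurable_fun [set: measurableTypeR R] (fun y : measurableTypeR R => g (x + p * y)).
Proof. exact: (continuous_measurable_fun (@cshift x p)). Qed.

Let mlin2 (x p q : R) :
  measurable_fun [set: measurableTypeR R * measurableTypeR R]
    (fun z : measurableTypeR R * measurableTypeR R => g (x + p * z.1 + q * z.2)).
Proof.
have mg : measurable_fun [set: R] g by exact: continuous_measurable_fun.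
apply: (measurableT_comp mg); apply: measurable_funD.
  by apply: measurable_funD => //; apply: measurable_funM => //; exact: measurable_fst.
by apply: measurable_funM => //; exact: measurable_snd.
Qed.

(** [Phi] of the conditional mean of [g (x + p W)] given [x], with [W] standard normal. With
    [p ^+ 2 + q ^+ 2 = 1], [E Phi(g) - E V q (p Z)] is the mean entropy left in an increment of
    variance [q ^+ 2]. *)
Let V (p x : R) : R := Phi (\int[gamma]_w g (x + p * w)).

Let mean_ab (p x : R) : a <= \int[gamma]_w g (x + p * w) <= b.
Proof. exact: Rintegral_bounds. Qed.

Let bmg (x p : R) : bounded_mfun (fun y : measurableTypeR R => g (x + p * y)).
Proof. exact: (bmfun_bounds loa bhi). Qed.

Let mean_continuous (p : R) : continuous (fun x => \int[gamma]_w g (x + p * w)).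
Proof.
move=> x.
apply: (@continuity_under_integral R _ _ gamma (fun x w => g (x + p * w)) setT
  measurableT (x - 1) (x + 1) _ _ (fun=> `|a| + `|b|)).
- by move=> y _; exact: bmfun_integrable.
- apply: aeW => w _ y _; apply: (@continuous_comp _ _ _ (fun x => x + p * w) g); last exact: cg.
  by apply: cvgD; [exact: cvg_id|exact: cvg_cst].
- by apply: bmfun_integrable; exact: bmfun_cst.
- move=> y _; apply: aeW => w _; have /andP[h1 h2] := gab (y + p * w).
  have := ler_norm (- a); have := ler_norm b; have := normr_ge0 a.
  by have := normr_ge0 b; rewrite normrN ler_norml => *; apply/andP; split; lra.
- by rewrite inE /= in_itv /=; lra.
Qed.

Let V_continuous (p : R) : continuous (V p).
Proof.
move=> x; apply: (@continuous_comp _ _ _ (fun x => \int[gamma]_w g (x + p * w)) Phi).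
  exact: mean_continuous.
exact: (cPhi (inside (mean_ab p x))).
Qed.

Let Phi_bound : exists N, forall u, a <= u <= b -> `|Phi u| <= N.
Proof. exact: continuous_bounded_segment loa bhi cPhi. Qed.

Let cPg : continuous (fun x => Phi (g x)).
Proof.
move=> x; apply: (@continuous_comp _ _ _ g Phi); first exact: cg.
exact: (cPhi (inside (gab _))).
Qed.

Let Phig_continuous (p q : R) : continuous (fun x => Phi (g (p + q * x))).
Proof.
move=> x; apply: (@continuous_comp _ _ _ (fun x => g (p + q * x)) Phi).
  exact: cshift.
exact: (cPhi (inside (gab _))).
Qed.

(* The law [N(0, q^2)] is that of [(q s) w1 + (q s) w2] with [s^2 = 1/2];
   subadditivity across [w1], [w2] halves the variance of the increment. *)
Let halving (p q r s : R) : 0 <= p -> 0 < q -> 0 < s -> s ^+ 2 = 2^-1 ->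
  p ^+ 2 + q ^+ 2 = 1 -> 0 <= r -> r ^+ 2 = p ^+ 2 + (q * s) ^+ 2 ->
  2 * \int[gamma]_z V (q * s) (r * z) <=
  \int[gamma]_z Phi (g z) + \int[gamma]_z V q (p * z).
Proof.
move=> p0 q0 s0 s2 pq1 r0 r2.
pose q' := q * s; have q'0 : 0 < q' by rewrite mulr_gt0.
have rp : 0 < r.
  rewrite lt_neqAle r0 andbT; apply/eqP => re.
  have : 0 < r ^+ 2 by rewrite r2 ltr_wpDl ?sqr_ge0// exprn_gt0.
  by rewrite -re expr0n ltxx.
have [N hN] := Phi_bound.
have step (x : R) : 2 * \int[gamma]_w V q' (x + q' * w) <=
    \int[gamma]_w Phi (g (x + q * w)) + V q x.
  have sub := @phi_subadditive R lo hi a b Phi Phi1 Phi2 adm loa bhi _ _ _ _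
    gamma gamma (fun z => g (x + q' * z.1 + q' * z.2)) (mlin2 x q' q') (fun z => gab _).
  move: sub; rewrite /=.
  (* [w1] and [w2] play symmetric roles, so the two partial-mean terms coincide: hence the factor
     2. *)
  have -> : \int[gamma]_y Phi (\int[gamma]_x0 g (x + q' * x0 + q' * y)) =
      \int[gamma]_w V q' (x + q' * w).
    apply: eq_Rintegral => y _; congr Phi; apply: eq_Rintegral => w _.
    by congr g; ring.
  rewrite -/(V q' _).
  have bG := bmfun_bounds loa bhi (mlin2 x q' q') (fun z => gab _).
  have bPG := bmfun_phi adm loa bhi (mlin2 x q' q') (fun z => gab _).
  rewrite (Rintegral_prod12 _ _ bG) (Rintegral_prod12 _ _ bPG) /=.
  have e w1 w2 : x + q' * w1 + q' * w2 = x + q * (s * w1 + s * w2).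
    by rewrite /q'; ring.
  have ss : s ^+ 2 + s ^+ 2 = 1 by rewrite s2; lra.
  under [X in _ <= X + _ -> _]eq_Rintegral do under eq_Rintegral do rewrite e.
  rewrite (gaussian_rotation (F := fun w => Phi (g (x + q * w))) s0 ss)//; last first.
    by exists N => w; apply: hN.
  under [X in _ <= _ + Phi X -> _]eq_Rintegral do under eq_Rintegral do rewrite e.
  rewrite (gaussian_rotation (F := fun w => g (x + q * w)) s0 ss)//; last first.
    have [_ [K hK]] := bmg x q; by exists K.
  by rewrite -/(V q x); move=> h; rewrite mulr_natl mulr2n.
have VN p' x : `|V p' x| <= N by apply: hN; exact: mean_ab.
have blin (F : R -> R) (u v : R) : bounded_mfun (F : measurableTypeR R -> R) ->
    bounded_mfun (fun z : measurableTypeR R * measurableTypeR R => F (u * z.1 + v * z.2)).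
  apply: (bmfun_comp (T2 := measurableTypeR R)).
  by apply: measurable_funD; apply: measurable_funM.
have bV2 : bounded_mfun (fun z : measurableTypeR R * measurableTypeR R =>
    V q' (p * z.1 + q' * z.2)).
  by apply: blin; apply: bmfun_continuous; [exact: V_continuous|exists N].
have PgN : exists N, forall x, `|Phi (g x)| <= N.
  by exists N => x; exact: hN.
have bP2 : bounded_mfun (fun z : measurableTypeR R * measurableTypeR R =>
    Phi (g (p * z.1 + q * z.2))).
  by apply: (blin (fun x => Phi (g x))); exact: bmfun_continuous.
have bVp : bounded_mfun (fun z : measurableTypeR R => V q (p * z)).
  apply: (bmfun_continuous (F := fun z => V q (p * z))); last by exists N.
  move=> x; apply: (@continuous_comp _ _ _ (fun x => p * x) (V q)).
    by apply: cvgM; [exact: cvg_cst|exact: cvg_id].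
  exact: V_continuous.
have rot : \int[gamma]_z V q' (r * z) =
    \int[gamma]_z \int[gamma]_w V q' (p * z + q' * w).
  rewrite -(@gaussian_rotation R (fun x => V q' (r * x)) (p / r) (q' / r)).
  - by apply: eq_Rintegral => z _; apply: eq_Rintegral => w _; congr V; field; lra.
  - by rewrite divr_gt0.
  - by rewrite !expr_div_n -mulrDl -r2 divff// sqrf_eq0 gt_eqF.
  - move=> x; apply: (@continuous_comp _ _ _ (fun x => r * x) (V q')).
      by apply: cvgM; [exact: cvg_cst|exact: cvg_id].
    exact: V_continuous.
  - by exists N => x.
rewrite rot -(gaussian_rotation q0 pq1 cPg PgN).
have bO := bmfun_Rintegral2 gamma gamma bV2.
have bO' := bmfun_Rintegral2 gamma gamma bP2.
rewrite -RintegralZl//; last exact: bmfun_integrable.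
rewrite -RintegralD//; [|exact: bmfun_integrable..].
apply: le_Rintegral => //.
- by apply: bmfun_integrable; apply: bmfunM => //; exact: bmfun_cst.
- by apply: bmfun_integrable; exact: bmfunD.
Qed.

(** [scale k] is the standard deviation [2^(-k/2)] of the remaining increment, and [coscale k] that
    of the independent frozen part, so that the variances sum to 1. *)
Variables (s : R) (scale coscale : nat -> R).
Hypotheses (s_gt0 : 0 < s) (s_sqr : s ^+ 2 = 2^-1).
Hypotheses (scale0 : scale 0 = 1) (scaleS : forall k, scale k.+1 = scale k * s).
Hypothesis coscale_ge0 : forall k, 0 <= coscale k.
Hypothesis coscale_sqr : forall k, coscale k ^+ 2 = 1 - scale k ^+ 2.

Let scale_gt0 k : 0 < scale k.
Proof. by elim: k => [|k IHk]; rewrite ?scale0// scaleS mulr_gt0. Qed.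

Let scale_sqr k : scale k ^+ 2 = 2^-1 ^+ k.
Proof.
elim: k => [|k IHk]; first by rewrite scale0 expr1n expr0.
by rewrite scaleS exprMn IHk s_sqr exprSr.
Qed.

(** At [k = 0] nothing is frozen and [V] is the constant [Phi (E g)]; each further step is [halving]
    between consecutive scales, at the cost of a factor 2. *)
Let entropy_dyadic k :
  \int[gamma]_z Phi (g z) - Phi (\int[gamma]_z g z) <=
  2 ^+ k * (\int[gamma]_z Phi (g z) - \int[gamma]_z V (scale k) (coscale k * z)).
Proof.
elim: k => [|k IHk].
  rewrite expr0 mul1r.
  have coscale0 : coscale 0 = 0.
    by apply/eqP; rewrite -sqrf_eq0 coscale_sqr scale0 expr1n subrr.
  rewrite lerD2l lerN2 -[leRHS](Rintegral_prob_cst gamma).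
  rewrite le_eqVlt; apply/orP; left; apply/eqP; apply: eq_Rintegral => z _.
  rewrite /V; congr Phi; apply: eq_Rintegral => w _; congr g.
  by rewrite coscale0 scale0 mul0r add0r mul1r.
apply: (le_trans IHk); rewrite exprSr -mulrA.
apply: ler_wpM2l; first by rewrite exprn_ge0.
have sq : coscale k ^+ 2 + scale k ^+ 2 = 1 by rewrite coscale_sqr subrK.
have sqS : coscale k.+1 ^+ 2 = coscale k ^+ 2 + (scale k * s) ^+ 2.
  by rewrite -scaleS !coscale_sqr !scale_sqr exprS; field.
have := halving (coscale_ge0 k) (scale_gt0 k) s_gt0 s_sqr sq (coscale_ge0 k.+1) sqS.
rewrite -scaleS.
move: (\int[gamma]_z V _ _) (\int[gamma]_z V _ _) (\int[gamma]_z Phi _) => x y z.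
lra.
Qed.

Local Notation plane := (measurableTypeR R * measurableTypeR R)%type.

Let D k (z : plane) : R :=
  bregman Phi Phi1 (g (coscale k * z.1 + scale k * z.2)) (g (coscale k * z.1)).

Let mg2 (p q : R) : measurable_fun [set: plane] (fun z : plane => g (p * z.1 + q * z.2)).
Proof. by have := mlin2 0 p q; under eq_fun do rewrite add0r. Qed.

Let mg1 (p : R) : measurable_fun [set: plane] (fun z : plane => g (p * z.1)).
Proof. by have := mg2 p 0; under eq_fun do rewrite mul0r addr0. Qed.

Let bD k : bounded_mfun (D k).
Proof.
have bu := bmfun_bounds loa bhi (mg2 (coscale k) (scale k)) (fun z => gab _).
have bPu := bmfun_phi adm loa bhi (mg2 (coscale k) (scale k)) (fun z => gab _).
have bv := bmfun_bounds loa bhi (mg1 (coscale k)) (fun z => gab _).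
have bPv := bmfun_phi adm loa bhi (mg1 (coscale k)) (fun z => gab _).
have bP1v := bmfun_phi1 adm loa bhi (mg1 (coscale k)) (fun z => gab _).
rewrite /D /bregman; apply: bmfunB; first exact: bmfunB.
by apply: bmfunM => //; exact: bmfunB.
Qed.

(** The conditional mean inside [V] is not explicit. By [bregman_mean], replacing it with the value
    [g (coscale k * z)] before the increment can only enlarge the bound, which then becomes
    explicit. *)
Let entropy_le_D k :
  \int[gamma]_z Phi (g z) - Phi (\int[gamma]_z g z) <=
  \int[(gamma \x gamma)%E]_z (2 ^+ k * D k z).
Proof.
rewrite RintegralZl//; last exact: bmfun_integrable.
apply: (le_trans (entropy_dyadic k)); apply: ler_wpM2l; first by rewrite exprn_ge0.
have [N hN] := Phi_bound.
have PgN : exists N, forall x, `|Phi (g x)| <= N by exists N => x; exact: hN.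
have sq : coscale k ^+ 2 + scale k ^+ 2 = 1 by rewrite coscale_sqr subrK.
rewrite -(gaussian_rotation (scale_gt0 k) sq cPg PgN) Rintegral_prod12//.
have bP2 := bmfun_phi adm loa bhi (mg2 (coscale k) (scale k)) (fun z => gab _).
have bO := bmfun_Rintegral2 gamma gamma bP2.
have bVp : bounded_mfun (fun z : measurableTypeR R => V (scale k) (coscale k * z)).
  apply: (bmfun_continuous (F := fun z => V (scale k) (coscale k * z))); last first.
    by exists N => x; apply: hN; exact: mean_ab.
  move=> x; apply: (@continuous_comp _ _ _ (fun x => coscale k * x) (V (scale k))).
    by apply: cvgM; [exact: cvg_cst|exact: cvg_id].
  exact: V_continuous.
rewrite -RintegralB//; [|exact: bmfun_integrable..].
apply: le_Rintegral => //.
- by apply: bmfun_integrable; exact: bmfunB.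
- exact: bmfun_integrable (bmfun_Rintegral2 gamma gamma (bD k)).
- move=> z _; apply: (bregman_mean adm loa bhi gamma
    (f := fun w => g (coscale k * z + scale k * w)) (c := g (coscale k * z))) => //.
Qed.

(** [tr.1] locates the Taylor point of [Phi], [tr.2] the mean value point of [g]. The factor
    [2 ^+ k] cancels [scale k ^+ 2], leaving a quantity of order one. *)
Let D_taylor k (z : plane) : exists tr : R * R,
  [/\ 0 <= tr.1 <= 1, 0 <= tr.2 <= 1 & 2 ^+ k * D k z =
  Phi2 (g (coscale k * z.1) +
    tr.1 * (g (coscale k * z.1 + scale k * z.2) - g (coscale k * z.1))) *
  g' (coscale k * z.1 + tr.2 * (scale k * z.2)) ^+ 2 * (z.2 ^+ 2 / 2)].
Proof.
set v := coscale k * z.1; set h := scale k * z.2.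
rewrite -[D k z]/(bregman Phi Phi1 (g (v + h)) (g v)).
have [t t01 ->] := bregman_taylor adm (inside (gab (v + h))) (inside (gab v)).
have [r _|r /andP[r0 r1]] := @MVT_is_derive R (fun r => g (v + r * h))
    (fun r => g' (v + r * h) * h) 0 1 ltr01.
  have hr : is_derive r 1 (fun r : R => v + r * h) h.
    by apply: is_derive_eq; rewrite /= /GRing.scale /=; ring.
  exact: (@is_derive1_comp R g (fun r : R => v + r * h) r _ _ (dg _) hr).
rewrite mul1r mul0r addr0 subr0 mulr1 => e.
exists (t, r) => /=; split => //; first by rewrite !ltW.
rewrite -/h e exprMn /h exprMn scale_sqr exprVn.
by field; rewrite expf_neq0.
Qed.

Let cvg_scale0 : scale k @[k --> \oo] --> (0 : R).
Proof.
have -> : scale = (fun k => s ^+ k).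
  by apply/funext; elim=> [|k IHk]; rewrite ?scale0 ?expr0// scaleS IHk exprSr.
apply: cvg_expr; rewrite gtr0_norm// ltNge; apply/negP => s1.
by move: s_sqr s1; rewrite expr2; nra.
Qed.

Let cvg_coscale1 : coscale k @[k --> \oo] --> (1 : R).
Proof.
have -> : coscale = (fun k => Num.sqrt (1 - scale k ^+ 2)).
  by apply/funext => k; rewrite -coscale_sqr sqrtr_sqr ger0_norm.
rewrite -[X in _ --> X]sqrtr1; apply: (continuous_cvg _ (@sqrt_continuous R 1)).
rewrite -[X in _ --> X]subr0; apply: cvgB; first exact: cvg_cst.
have := continuous_cvg _ (@exprn_continuous R 2 0) cvg_scale0.
by rewrite /= expr0n => h; exact: h.
Qed.

Let cvg_damped (t u : nat -> R) : (forall k, 0 <= t k <= 1) ->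
  u k @[k --> \oo] --> (0 : R) -> t k * u k @[k --> \oo] --> (0 : R).
Proof.
move=> t01 /cvgr0Pnorm_lt u0; apply/cvgr0Pnorm_lt => e /u0.
apply: filterS => k; apply: le_lt_trans; have /andP[h0 h1] := t01 k.
by rewrite normrM (ger0_norm h0) ler_piMl.
Qed.

Let D_cvg (z : plane) : 2 ^+ k * D k z @[k --> \oo] -->
  (Phi2 (g z.1) * g' z.1 ^+ 2 * (z.2 ^+ 2 / 2) : R).
Proof.
(* With [z] fixed, the chosen points may vary arbitrarily with [k]: lying in [[0, 1]] suffices, as
   they only multiply quantities that tend to 0. *)
have [tr htr] := choice (fun k => D_taylor k z).
pose y k := coscale k * z.1; pose h k := scale k * z.2.
have cy : y k @[k --> \oo] --> z.1.
  by rewrite -[X in _ --> X]mul1r; apply: cvgM => //; exact: cvg_cst.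
have ch : h k @[k --> \oo] --> (0 : R).
  by rewrite -(mul0r z.2); apply: cvgM => //; exact: cvg_cst.
have cyh (t : nat -> R) : (forall k, 0 <= t k <= 1) ->
    y k + t k * h k @[k --> \oo] --> z.1.
  by move=> t01; rewrite -[X in _ --> X]addr0; apply: cvgD => //; exact: cvg_damped.
have cgy : g (y k) @[k --> \oo] --> g z.1 by apply: continuous_cvg => //; exact: cg.
have cgu : g (y k + h k) @[k --> \oo] --> g z.1.
  apply: continuous_cvg; first exact: cg.
  by rewrite -[X in _ --> X]addr0; apply: cvgD.
have cdiff : g (y k + h k) - g (y k) @[k --> \oo] --> (0 : R).
  by rewrite -(subrr (g z.1)); apply: cvgB.
have ctheta : g (y k) + (tr k).1 * (g (y k + h k) - g (y k)) @[k --> \oo] --> g z.1.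
  rewrite -[X in _ --> X]addr0; apply: cvgD => //.
  by apply: cvg_damped => // k; have [] := htr k.
have -> : (fun k => 2 ^+ k * D k z) = (fun k =>
    Phi2 (g (y k) + (tr k).1 * (g (y k + h k) - g (y k))) *
    g' (y k + (tr k).2 * h k) ^+ 2 * (z.2 ^+ 2 / 2)).
  by apply/funext => k; have [_ _ ->] := htr k.
apply: cvgM; last exact: cvg_cst.
apply: cvgM.
  by apply: continuous_cvg => //; case: adm => _ _ + _ _; apply; exact: inside.
apply: (continuous_cvg _ (@exprn_continuous R 2 _)).
by apply: continuous_cvg; [exact: cg'|apply: cyh => k; have [] := htr k].
Qed.

Let Phi2_bound : exists K, forall u, a <= u <= b -> Phi2 u <= K.
Proof.
case: adm => _ _ cPhi2 _ _.
have [K hK] := continuous_bounded_segment loa bhi cPhi2.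
by exists K => u /hK; exact: le_trans (ler_norm _).
Qed.

(** Uniform in [k], and integrable by the Gaussian second moment: the majorant for dominated
    convergence. *)
Let D_dominated K k z : (forall u, a <= u <= b -> Phi2 u <= K) ->
  `|2 ^+ k * D k z| <= K * M ^+ 2 * (z.2 ^+ 2 / 2).
Proof.
move=> hK; have [[t r] /= [/andP[t0 t1] _ ->]] := D_taylor k z.
set u := g (_ + _ * z.2); set v := g (_ * z.1); set x := coscale k * z.1 + _.
have uab : a <= u <= b by exact: gab.
have vab : a <= v <= b by exact: gab.
have uvab : a <= v + t * (u - v) <= b.
  by move/andP: uab => [? ?]; move/andP: vab => [? ?]; apply/andP; split; nra.
have P2 : 0 < Phi2 (v + t * (u - v)).
  by case: adm => _ _ _ + _; apply; exact: inside.
have w2 : 0 <= z.2 ^+ 2 / 2 by rewrite divr_ge0 ?sqr_ge0.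
rewrite ger0_norm; last by rewrite mulr_ge0// mulr_ge0 ?sqr_ge0// ltW.
apply: ler_wpM2r => //; apply: ler_pM; rewrite ?sqr_ge0 ?(ltW P2) ?hK//.
by rewrite -[leLHS]real_normK ?num_real// lerXn2r ?nnegrE// (le_trans _ (g'M x)).
Qed.

Lemma phi_sobolev_gaussian1_dyadic :
  \int[gamma]_z Phi (g z) <= Phi (\int[gamma]_z g z) +
  2^-1 * \int[gamma]_z (Phi2 (g z) * g' z ^+ 2).
Proof.
have [K hK] := Phi2_bound.
pose F (z : plane) : R := Phi2 (g z.1) * g' z.1 ^+ 2 * (z.2 ^+ 2 / 2).
pose G (z : plane) : R := K * M ^+ 2 * (z.2 ^+ 2 / 2).
have Phi2_gt0 x : 0 < Phi2 (g x) by case: adm => _ _ _ + _; apply; exact: inside.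
have mP2 : measurable_fun [set: measurableTypeR R]
    (fun x : measurableTypeR R => Phi2 (g x) * g' x ^+ 2).
  apply: (continuous_measurable_fun (f := fun x => Phi2 (g x) * g' x ^+ 2)) => x.
  apply: cvgM; last first.
    by apply: (continuous_cvg _ (@exprn_continuous R 2 _)); exact: cg'.
  apply: continuous_cvg; last exact: cg.
  by case: adm => _ _ + _ _; apply; exact: inside.
have mw2 : measurable_fun [set: plane] (fun z : plane => z.2 ^+ 2 / 2).
  apply: measurable_funM => //.
  by apply: measurable_funX; exact: measurable_snd.
have mF : measurable_fun setT (EFin \o F).
  apply/measurable_EFinP; apply: measurable_funM => //.
  exact: (measurableT_comp mP2 measurable_fst).
have mG : measurable_fun setT (EFin \o G).
  by apply/measurable_EFinP; apply: measurable_funM.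
have K0 : 0 <= K * M ^+ 2.
  by rewrite mulr_ge0 ?sqr_ge0// (le_trans (ltW (Phi2_gt0 0)))// hK.
pose half_sqr (w : measurableTypeR R) : R := w ^+ 2 / 2.
have ih : gamma.-integrable setT (EFin \o half_sqr).
  rewrite /comp /half_sqr; under eq_fun do rewrite EFinM.
  by apply: integrableZr => //; exact: gaussian_integrable_sqr.
have mh := measurable_int gamma ih.
have h0 w : (0 <= (EFin \o half_sqr) w)%E by rewrite lee_fin divr_ge0 ?sqr_ge0.
(* Origin of the final constant: the Taylor coefficient 1/2 times the unit second moment. *)
have iw : (\int[gamma]_w (EFin \o half_sqr) w = (2^-1)%:E)%E.
  rewrite -[LHS]fineK; last exact: (integrable_fin_num _ ih).
  rewrite -[X in X%:E]/(\int[gamma]_w (w ^+ 2 / 2)) RintegralZr//; last exact: gaussian_integrable_sqr.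
  by rewrite gaussian_second_moment mul1r.
have iconst (c : R) : 0 <= c ->
    (\int[gamma]_w (c * half_sqr w)%:E = (c * 2^-1)%:E)%E.
  move=> c0; under eq_integral do rewrite EFinM.
  by rewrite (ge0_integralZl _ _ mh)// ?iw ?lee_fin.
have iG : (gamma \x gamma)%E.-integrable setT (EFin \o G).
  apply/integrable12ltyP => //.
  under eq_integral => x _.
    under eq_integral => w _.
      rewrite /= ger0_norm; last exact: mulr_ge0 K0 (divr_ge0 (sqr_ge0 w) (ler0n _ 2)).
      over.
    rewrite (iconst _ K0).
    over.
  by rewrite integral_cst//= probability_setT mule1 ltry.
pose Dk k (z : plane) : \bar R := (2 ^+ k * D k z)%:E.
have iDk k : (gamma \x gamma)%E.-integrable setT (Dk k).
  by apply: bmfun_integrable; apply: bmfunM => //; exact: bmfun_cst.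
have cDk z : Dk k z @[k --> \oo] --> (F z)%:E.
  by apply: cvg_EFin; [exact: nearW|exact: D_cvg].
have dDk z k : (`|Dk k z| <= (G z)%:E)%E by rewrite lee_fin; exact: D_dominated.
have [iF _ cF] := @dominated_convergence _ _ _ (gamma \x gamma)%E setT measurableT
  Dk (EFin \o F) (EFin \o G) (fun k => measurable_int _ (iDk k)) mF
  (aeW _ (fun z _ => cDk z)) iG (aeW _ (fun z k _ => dDk z k)).
have bc : bounded_mfun (fun z : measurableTypeR R => Phi2 (g z) * g' z ^+ 2).
  split=> //; exists (K * M ^+ 2) => z.
  rewrite ger0_norm; last by rewrite mulr_ge0 ?sqr_ge0// ltW.
  apply: ler_pM; rewrite ?sqr_ge0 ?(ltW (Phi2_gt0 _)) ?hK//.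
  by rewrite -[leLHS]real_normK ?num_real// lerXn2r ?nnegrE// (le_trans _ (g'M z)).
have FE : (\int[(gamma \x gamma)%E]_z (F z)%:E =
    \int[gamma]_z (Phi2 (g z) * g' z ^+ 2 * 2^-1)%:E)%E.
  rewrite [LHS](@fubini_tonelli1 _ _ _ _ _ gamma gamma (EFin \o F))//; last first.
    move=> z; rewrite lee_fin; apply: mulr_ge0; last by rewrite divr_ge0 ?sqr_ge0.
    by apply: mulr_ge0; [exact: ltW|exact: sqr_ge0].
  apply: eq_integral => x _; rewrite /fubini_F /F /=.
  by apply: iconst; rewrite mulr_ge0 ?sqr_ge0// ltW.
(* The entropy does not depend on [k], so its bound passes to the limit of the integrals. *)
have : ((\int[gamma]_z Phi (g z) - Phi (\int[gamma]_z g z))%:E <=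
    \int[(gamma \x gamma)%E]_z (F z)%:E)%E.
  apply: (cvge_ge _ cF); apply: nearW => k.
  have := entropy_le_D k; rewrite -lee_fin => /le_trans; apply.
  by rewrite fineK//; exact: (integrable_fin_num _ (iDk k)).
have ic : gamma.-integrable setT (EFin \o (fun z => Phi2 (g z) * g' z ^+ 2 * 2^-1)).
  by apply: bmfun_integrable; apply: bmfunM => //; exact: bmfun_cst.
rewrite FE -[leRHS]fineK; last exact: integrable_fin_num.
rewrite lee_fin -/(Rintegral _ _ _) RintegralZr//; last exact: bmfun_integrable.
lra.
Qed.

End one_dimension.

Theorem phi_sobolev_gaussian1 (R : realType) (lo hi a b : R)
    (Phi Phi1 Phi2 g g' : R -> R) (M : R) :
  admissible_phi lo hi Phi Phi1 Phi2 -> lo < a -> b < hi ->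
  (forall x : R, is_derive x 1 g (g' x)) -> continuous g' ->
  (forall x, `|g' x| <= M) -> (forall x, a <= g x <= b) ->
  \int[std_normal R]_z Phi (g z) <= Phi (\int[std_normal R]_z g z) +
  2^-1 * \int[std_normal R]_z (Phi2 (g z) * g' z ^+ 2).
Proof.
move=> adm loa bhi dg cg' g'M gab.
pose s : R := Num.sqrt 2^-1; pose q k := s ^+ k.
have s0 : 0 < s by rewrite sqrtr_gt0 invr_gt0.
have s2 : s ^+ 2 = 2^-1 by rewrite sqr_sqrtr// invr_ge0.
apply: (@phi_sobolev_gaussian1_dyadic R lo hi a b Phi Phi1 Phi2 adm loa bhi g g' M
  dg cg' g'M gab s q (fun k => Num.sqrt (1 - q k ^+ 2))) => //.
- by move=> k; rewrite /q exprSr.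
- move=> k; rewrite sqr_sqrtr// subr_ge0 /q -exprM mulnC exprM s2.
  by rewrite exprn_ile1// ?invr_ge0// invf_le1// ler1n.
Qed.

(** * The entropy inequality in any dimension *)

Section row_vectors.
Context {R : realType}.

(* A continuous function is the limit of its values on the grids of mesh
   [1/n.+1], and a function of the grid point takes countably many values. *)
Lemma continuous_measurable_rV d (F : 'rV[R]_d -> R) :
  continuous F -> measurable_fun [set: 'rV[R]_d] F.
Proof.
move=> cF.
pose grid (n : nat) (k : 'rV[int]_d) : 'rV[R]_d := \row_i ((k ord0 i)%:~R / n.+1%:R).
pose cell (n : nat) (x : 'rV[R]_d) : 'rV[int]_d :=
  \row_i Num.floor (x ord0 i * n.+1%:R).
apply: (measurable_fun_cvg (h := fun n x => F (grid n (cell n x)))) => [n|x _].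
  move=> _ A mA; rewrite setTI.
  have -> : (fun x => F (grid n (cell n x))) @^-1` A =
      \bigcup_(k in [set: 'rV[int]_d]) [set x | A (F (grid n k)) /\ cell n x = k].
    by apply/seteqP; split => x /= => [h|[k _ [h e]]]; [by exists (cell n x)|by rewrite e].
  apply: countable_bigcupT_measurable; first exact: countableP.
  move=> k.
  have [Ak|nAk] := pselect (A (F (grid n k))); last first.
    rewrite (_ : [set _ | _] = set0)//; by apply/seteqP; split => x // -[].
  rewrite (_ : [set _ | _] = \bigcap_(i in [set: 'I_d])
      ((fun x : 'rV[R]_d => x ord0 i * n.+1%:R) @^-1`
        `[(k ord0 i)%:~R, (k ord0 i + 1)%:~R[)); last first.
    apply/seteqP; split => x /=.
      by move=> [_ e] i _ /=; rewrite in_itv /= -e mxE floor_itv.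
    move=> h; split=> //; apply/rowP => i; rewrite mxE; apply/eqP.
    by rewrite floor_eq; have := h i I; rewrite /= in_itv.
  apply: fin_bigcap_measurable => // i _.
  rewrite -[X in measurable X]setTI.
  by apply: (measurable_funM (measurable_coord (T := R) i) (measurable_cst _)).
suff : grid n (cell n x) @[n --> \oo] --> x by move=> /(continuous_cvg _ (cF x)).
apply/cvg_ballP => e e0; near=> n; split=> // i j.
rewrite ord1 /ball /= !mxE.
have n0 : (0 : R) < n.+1%:R by rewrite ltr0n.
have en : n.+1%:R^-1 < e by near: n; exact: (near_infty_natSinv_lt (PosNum e0)).
apply: le_lt_trans en; have /andP[h1 h2] := floor_itv (x ord0 j * n.+1%:R).
rewrite -(ler_pM2r n0) mulVf ?gt_eqF// -[X in _ * X](gtr0_norm n0) -normrM.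
rewrite mulrBl divfK ?gt_eqF// ger0_norm ?subr_ge0//.
by move: h2; rewrite intrD; lra.
Unshelve. all: by end_near. Qed.

(** Both arguments are in the form [h *: v + a] of a difference quotient, as [is_derive_congr]
    expects, to identify a partial derivative with the derivative of a slice. *)
Lemma cons_rV_shift0 d (h x : R) (y : 'rV[R]_d) :
  cons_rV (h *: 1 + x, y) = h *: delta_mx ord0 ord0 + cons_rV (x, y).
Proof.
apply/rowP => i; rewrite [RHS]mxE [in RHS]mxE [in RHS]mxE.
case: (unliftP ord0 i) => [j|] ->.
  by rewrite [lift _ _ == _]eq_sym (negbTE (neq_lift _ _)) andbF mulr0 add0r !cons_rVS.
by rewrite !cons_rV0.
Qed.

Lemma cons_rV_shiftS d (h x : R) (y : 'rV[R]_d) (j : 'I_d) :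
  cons_rV (x, h *: delta_mx ord0 j + y) =
  h *: delta_mx ord0 (lift ord0 j) + cons_rV (x, y).
Proof.
apply/rowP => i; rewrite [RHS]mxE [in RHS]mxE [in RHS]mxE.
case: (unliftP ord0 i) => [k|] ->.
  by rewrite (inj_eq (@lift_inj _ ord0)) !cons_rVS !mxE.
by rewrite (negbTE (neq_lift _ _)) andbF mulr0 add0r !cons_rV0.
Qed.

Lemma continuous_cons_rVl d (y : 'rV[R]_d) : continuous (fun x : R => cons_rV (x, y)).
Proof.
move=> x; apply/(@cvg_ballP _ _ _ (nbhs x)) => e e0; near=> z; split=> // i j; rewrite ord1.
have xz : ball x e z by near: z; exact: nbhsx_ballx.
case: (unliftP ord0 j) => [k|] ->; rewrite ?cons_rVS ?cons_rV0 //=.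
exact: ballxx.
Unshelve. all: by end_near. Qed.

Lemma continuous_cons_rVr d (x : R) :
  continuous (fun y : 'rV[R]_d => cons_rV (x : measurableTypeR R, y)).
Proof.
move=> y; apply/(@cvg_ballP _ _ _ (nbhs y)) => e e0; near=> z; split=> // i j; rewrite ord1.
have [_ yz] : ball y e z by near: z; exact: nbhsx_ballx.
case: (unliftP ord0 j) => [k|] ->; rewrite ?cons_rVS ?cons_rV0 //=.
exact: ballxx.
Unshelve. all: by end_near. Qed.

(** A directional derivative only sees the function along a line, whatever the ambient space: this
    moves derivatives between row vectors and their slices. *)
Lemma is_derive_congr (V1 V2 W : normedModType R) (f1 : V1 -> W) (f2 : V2 -> W)
    (a1 v1 : V1) (a2 v2 : V2) (df : W) :
  (forall h : R, f1 (h *: v1 + a1) = f2 (h *: v2 + a2)) ->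
  is_derive a1 v1 f1 df -> is_derive a2 v2 f2 df.
Proof.
move=> f12 [dvf <-].
have f12a : f1 a1 = f2 a2 by have := f12 0; rewrite !scale0r !add0r.
have e : (fun h : R => h^-1 *: ((f1 \o shift a1) (h *: v1) - f1 a1)) =
         (fun h : R => h^-1 *: ((f2 \o shift a2) (h *: v2) - f2 a2)).
  by apply/funext => h; rewrite /= f12 f12a.
by split; [move: dvf; rewrite /derivable e|rewrite /derive e].
Qed.

(** Regularity is phrased coordinate by coordinate because this form passes directly to the slices
    used in the induction on the dimension. *)
Definition bounded_partials d (g : 'rV[R]_d -> R) (G : 'I_d -> 'rV[R]_d -> R)
    (M : R) : Prop :=
  [/\ continuous g,
      (forall i x, is_derive x (delta_mx ord0 i) g (G i x)),
      (forall i, continuous (G i)) &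
      (forall i x, `|G i x| <= M)].

Lemma Rintegral_std_gaussianS d (F : 'rV[R]_d.+1 -> R) : bounded_mfun F ->
  \int[std_gaussian d.+1]_x F x =
  \int[(std_normal R \x std_gaussian d)%E]_z F (cons_rV z).
Proof.
move=> bF; congr fine.
apply: (integral_distribution (X := @cons_rV R d)
  (P := (std_normal R \x std_gaussian d)%E) (f := EFin \o F)).
- by apply/measurable_EFinP; case: bF.
- apply: (bmfun_integrable (std_normal R \x std_gaussian d)%E).
  by apply: bmfun_comp bF; exact: measurable_cons_rV.
Qed.

End row_vectors.

Section any_dimension.
Context {R : realType} (lo hi a b : R) (Phi Phi1 Phi2 : R -> R).
Hypothesis adm : admissible_phi lo hi Phi Phi1 Phi2.
Hypotheses (loa : lo < a) (bhi : b < hi).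
Local Notation gamma := (std_normal R).

Theorem phi_sobolev_gaussian d (g : 'rV[R]_d -> R) (G : 'I_d -> 'rV[R]_d -> R)
    (M : R) : bounded_partials g G M -> (forall x, a <= g x <= b) ->
  \int[std_gaussian d]_x Phi (g x) <= Phi (\int[std_gaussian d]_x g x) +
  2^-1 * \int[std_gaussian d]_x (Phi2 (g x) * \sum_(i < d) G i x ^+ 2).
Proof.
(* [A] is [E Phi(g)], [m] is [Phi (E g)], [u] and [v] are the partial-mean terms of
   [phi_subadditive], [t0] and [tS] the energies along the first and the other coordinates. Adding
   the first two bounds and inserting the third cancels one [A]. *)
have combine (A m t0 tS u v : R) : A <= v + 2^-1 * t0 ->
    A <= u + 2^-1 * tS -> u + v <= A + m -> A <= m + 2^-1 * (t0 + tS) by lra.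
elim: d g G M => [|d IHd] g G M [cg dg cG GM] gab.
  (* In dimension 0 the space is a point and both sides equal [Phi (g 0)]. *)
  have i0 (F : 'rV[R]_0 -> R) : \int[std_gaussian 0]_x F x = F 0.
    rewrite -[RHS](Rintegral_prob_cst (std_gaussian 0)).
    by apply: eq_Rintegral => x _; rewrite (thinmx0 x).
  by rewrite !i0 big_ord0 mulr0 mulr0 addr0.
have mg := continuous_measurable_rV cg.
have bg := bmfun_bounds loa bhi mg gab.
have bPg := bmfun_phi adm loa bhi mg gab.
have bP2 : bounded_mfun (fun x => Phi2 (g x)).
  by apply: (bmfun_comp_continuous loa bhi gab mg); case: adm.
have bG i : bounded_mfun (fun x => G i x ^+ 2).
  by apply: bmfunM; split; try exact: continuous_measurable_rV; exists M.
pose T0 x := Phi2 (g x) * G ord0 x ^+ 2.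
pose TS x := Phi2 (g x) * \sum_(j < d) G (lift ord0 j) x ^+ 2.
have bT0 : bounded_mfun T0 by exact: bmfunM.
have bTS : bounded_mfun TS by apply: bmfunM => //; exact: bmfun_sum.
have bc (F : 'rV[R]_d.+1 -> R) : bounded_mfun F ->
    bounded_mfun (fun z : measurableTypeR R * 'rV[R]_d => F (cons_rV z)).
  by apply: bmfun_comp; exact: measurable_cons_rV.
have slice_le dd (T : measurableType dd) (P : probability T R) (u v w : T -> R) :
    bounded_mfun u -> bounded_mfun v -> bounded_mfun w ->
    (forall x, u x <= v x + 2^-1 * w x) ->
    \int[P]_x u x <= \int[P]_x v x + 2^-1 * \int[P]_x w x.
  move=> bu bv bw uvw; rewrite -RintegralZl//; last exact: bmfun_integrable.
  have bw2 : bounded_mfun (fun x => 2^-1 * w x) by apply: bmfunM => //; exact: bmfun_cst.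
  rewrite -RintegralD//; [|exact: bmfun_integrable..].
  apply: le_Rintegral => //; first exact: bmfun_integrable.
  by apply: bmfun_integrable; exact: bmfunD.
have along0 (y : 'rV[R]_d) : \int[gamma]_x Phi (g (cons_rV (x, y))) <=
    Phi (\int[gamma]_x g (cons_rV (x, y))) +
    2^-1 * \int[gamma]_x T0 (cons_rV (x, y)).
  apply: (@phi_sobolev_gaussian1 R lo hi a b Phi Phi1 Phi2 (fun x : R => g (cons_rV (x, y)))
    (fun x => G ord0 (cons_rV (x, y))) M) => //.
  - by move=> x; apply: is_derive_congr (dg ord0 (cons_rV (x, y))) => h; rewrite -cons_rV_shift0.
  - move=> x; apply: (@continuous_comp _ _ _ (fun x : R => cons_rV (x, y)) (G ord0)).
      exact: continuous_cons_rVl.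
    exact: cG.
have alongS (x : measurableTypeR R) : \int[std_gaussian d]_y Phi (g (cons_rV (x, y))) <=
    Phi (\int[std_gaussian d]_y g (cons_rV (x, y))) +
    2^-1 * \int[std_gaussian d]_y TS (cons_rV (x, y)).
  apply: (IHd _ (fun j y => G (lift ord0 j) (cons_rV (x, y))) M) => //.
  split=> // [y|j y|j y].
  - apply: (@continuous_comp _ _ _ (fun y : 'rV[R]_d => cons_rV (x, y)) g); last exact: cg.
    exact: continuous_cons_rVr.
  - by apply: is_derive_congr (dg (lift ord0 j) (cons_rV (x, y))) => h; rewrite -cons_rV_shiftS.
  - apply: (@continuous_comp _ _ _ (fun y : 'rV[R]_d => cons_rV (x, y)) (G (lift ord0 j))).
      exact: continuous_cons_rVr.
    exact: cG.
pose P := (gamma \x std_gaussian d)%E.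
have hab (z : measurableTypeR R * 'rV[R]_d) : a <= g (cons_rV z) <= b by exact: gab.
have [mh _] := bc _ bg.
have sub := @phi_subadditive R lo hi a b Phi Phi1 Phi2 adm loa bhi _ _ _ _
  gamma (std_gaussian d) (fun z => g (cons_rV z)) mh hab.
rewrite !Rintegral_std_gaussianS//; last first.
  by apply: bmfunM => //; exact: bmfun_sum.
have -> : \int[P]_z (Phi2 (g (cons_rV z)) * \sum_(i < d.+1) G i (cons_rV z) ^+ 2) =
    \int[P]_z T0 (cons_rV z) + \int[P]_z TS (cons_rV z).
  rewrite -RintegralD//; [|by apply: bmfun_integrable; exact: bc..].
  by apply: eq_Rintegral => z _; rewrite big_ord_recl mulrDr.
have bvx := bmfun_Rintegral2 gamma (std_gaussian d) (bc _ bg).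
have bvy := bmfun_Rintegral1 gamma (std_gaussian d) (bc _ bg).
have vxab x : a <= \int[std_gaussian d]_y g (cons_rV (x, y)) <= b.
  by apply: Rintegral_bounds => //; case: (bmfun_pair1 x (bc _ bg)).
have vyab y : a <= \int[gamma]_x g (cons_rV (x, y)) <= b.
  by apply: Rintegral_bounds => //; case: (bmfun_pair2 y (bc _ bg)).
have entS := slice_le _ _ gamma _ _ _ (bmfun_Rintegral2 gamma _ (bc _ bPg))
  (bmfun_phi adm loa bhi bvx.1 vxab) (bmfun_Rintegral2 gamma _ (bc _ bTS)) alongS.
have ent0 := slice_le _ _ (std_gaussian d) _ _ _ (bmfun_Rintegral1 gamma (std_gaussian d) (bc _ bPg))
  (bmfun_phi adm loa bhi bvy.1 vyab) (bmfun_Rintegral1 gamma (std_gaussian d) (bc _ bT0)) along0.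
rewrite -(Rintegral_prod12 _ _ (bc _ bPg)) -(Rintegral_prod12 _ _ (bc _ bTS)) in entS.
rewrite -(Rintegral_prod21 _ _ (bc _ bPg)) -(Rintegral_prod21 _ _ (bc _ bT0)) in ent0.
exact: (combine _ _ _ _ _ _ ent0 entS sub).
Qed.

End any_dimension.

(** * The primitives G and H *)

Section primitives.
Context {R : realType}.
Variable c : R -> R.
Hypothesis c_gt0 : forall x : R, 0 < x -> 0 < c x.
Hypothesis c_derivable : forall x : R, 0 < x -> derivable c x 1.
Hypothesis c'_continuous : {in `]0, +oo[, continuous (derive1 c)}.
Hypothesis c'_gt0 : forall x : R, 0 < x -> 0 < derive1 c x.
Local Notation mu := (@lebesgue_measure R).
Local Notation c' := (derive1 c).
Local Notation G := (primG c).
Local Notation H := (primH c).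

Let dc (x : R) : 0 < x -> is_derive x 1 c (c' x).
Proof. by move=> x0; rewrite derive1E; apply: derivableP; exact: c_derivable. Qed.

Let cc (x : R) : 0 < x -> {for x, continuous c}.
Proof. by move=> /dc; exact: is_derive1_continuous. Qed.

Lemma c_incr (x y : R) : 0 < x -> x <= y -> c x <= c y.
Proof.
move=> x0; rewrite le_eqVlt => /predU1P[->//|xy].
have [|z /andP[xz zy] e] := @MVT_is_derive R c c' x y xy.
  by move=> z /andP[xz _]; apply: dc; exact: lt_le_trans xz.
rewrite -subr_ge0 e mulr_ge0 ?subr_ge0 ?(ltW xy)// ltW// c'_gt0//.
exact: lt_trans xz.
Qed.

Let dlnc (x : R) : 0 < x -> is_derive x 1 (fun y => ln (c y)) (c' x / c x).
Proof.
move=> x0; have := is_derive1_comp (is_derive1_ln (c_gt0 x0)) (dc x0).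
by rewrite mulrC.
Qed.

Let clnc (x : R) : 0 < x -> {for x, continuous (fun y => c y * ln (c y))}.
Proof.
move=> x0; apply: cvgM; first exact: cc.
exact: (is_derive1_continuous (dlnc x0)).
Qed.

Let integrable_bounded (f : R -> R) (u K : R) :
  (forall x : R, 0 < x -> {for x, continuous f}) ->
  (forall x, 0 < x <= u -> `|f x| <= K) ->
  mu.-integrable `]0, u] (EFin \o f).
Proof.
move=> cf fK.
have mf : measurable_fun (`]0, +oo[%classic : set R) f.
  by apply: open_continuous_measurable_fun => // x;
    rewrite inE /= in_itv /= andbT; exact: cf.
apply: measurable_bounded_integrable => //.
- by rewrite /= lebesgue_measure_itv /=; case: ifPn => _; rewrite ?ltry.
- apply: measurable_funS mf => //.
  by move=> x /=; rewrite !in_itv /= => /andP[->].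
- exists K; split; first by rewrite num_real.
  move=> y Ky x /=; rewrite in_itv /= => xu.
  by rewrite (le_trans (fK _ xu))// ltW.
Qed.

Let integrable_c (u : R) : mu.-integrable `]0, u] (EFin \o c).
Proof.
apply: (@integrable_bounded _ _ (c u)) => [x /cc//|x /andP[x0 xu]].
by rewrite gtr0_norm ?c_gt0// c_incr.
Qed.

(** [c] may tend to 0 at 0, where [ln (c x)] is unbounded; but [ln t < t] and [- ln t < t^-1]
    confine [t * ln t] between [-1] and [t ^+ 2], and [c] is increasing. *)
Let integrable_clnc (u : R) :
  mu.-integrable `]0, u] (EFin \o (fun x => c x * ln (c x))).
Proof.
apply: (@integrable_bounded _ _ (1 + c u ^+ 2)) => [x /clnc//|x /andP[x0 xu]].
have cx0 := c_gt0 x0; have cxu := c_incr x0 xu.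
have l1 := ln_sublinear cx0.
have l2 : - ln (c x) < (c x)^-1.
  by rewrite -lnV ?posrE//; apply: ln_sublinear; rewrite invr_gt0.
have e : c x * (c x)^-1 = 1 by rewrite divff// gt_eqF.
rewrite ler_norml; apply/andP; split; first by nra.
by nra.
Qed.

Lemma is_derive_primG (x : R) : 0 < x -> is_derive x 1 G (c x).
Proof.
move=> x0; have [||d e] := @continuous_FTC1 R c (BRight 0) x (x + 1) _ (integrable_c _) _ (cc x0).
- by rewrite ltrDl.
- by rewrite /= lte_fin.
by split; [exact: d|rewrite -derive1E; exact: e].
Qed.

Lemma is_derive_primH (x : R) : 0 < x -> is_derive x 1 H (c x * ln (c x)).
Proof.
move=> x0; have [||d e] := @continuous_FTC1 R (fun x => c x * ln (c x)) (BRight 0) x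
  (x + 1) _ (integrable_clnc _) _ (clnc x0).
- by rewrite ltrDl.
- by rewrite /= lte_fin.
by split; [exact: d|rewrite -derive1E; exact: e].
Qed.

Lemma primG_incr (x y : R) : 0 < x -> x < y -> G x < G y.
Proof.
move=> x0 xy.
have [|z /andP[xz zy] e] := @MVT_is_derive R G c x y xy.
  by move=> z /andP[xz _]; apply: is_derive_primG; exact: lt_le_trans xz.
rewrite -subr_gt0 e mulr_gt0 ?subr_gt0// c_gt0//.
exact: lt_trans xz.
Qed.

Lemma primG_ltE (x y : R) : 0 < x -> 0 < y -> (G x < G y) = (x < y).
Proof.
move=> x0 y0; apply/idP/idP; last exact: primG_incr.
apply: contraTT; rewrite -!leNgt le_eqVlt => /predU1P[->//|yx].
by rewrite ltW// primG_incr.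
Qed.

Lemma primG_leE (x y : R) : 0 < x -> 0 < y -> (G x <= G y) = (x <= y).
Proof. by move=> x0 y0; rewrite !leNgt primG_ltE. Qed.

Lemma primG_ge0 (x : R) : 0 <= G x.
Proof.
by apply: Rintegral_ge0 => y; rewrite /= in_itv /= => /andP[y0 _]; rewrite ltW// c_gt0.
Qed.

Lemma primGK (x : R) : 0 < x -> primGinv c (G x) = x.
Proof.
move=> x0; apply: pinvKV; last by rewrite inE /= in_itv /= x0.
move=> y z; rewrite !inE /= !in_itv /= !andbT => y0 z0 e.
by apply/eqP; rewrite eq_le -(primG_leE y0 z0) -(primG_leE z0 y0) e lexx.
Qed.

Lemma primG_onto (x y u : R) : 0 < x -> x <= y -> G x <= u <= G y ->
  exists2 z, x <= z <= y & G z = u.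
Proof.
move=> x0 xy /andP[xu uy].
have [||z zxy zu] := @IVT R G x y u xy.
- apply: continuous_in_subspaceT => z; rewrite inE /= in_itv /= => /andP[xz _].
  by apply: is_derive1_continuous; apply: is_derive_primG; exact: lt_le_trans xz.
- have Gxy : G x <= G y by exact: le_trans uy.
  by rewrite (min_idPl Gxy) (max_idPr Gxy) xu.
by exists z => //; move: zxy; rewrite in_itv.
Qed.

Lemma is_derive_primGinv (x : R) : 0 < x -> is_derive (G x) 1 (primGinv c) (c x)^-1.
Proof.
move=> x0; apply: is_derive_inverse.
- by near=> y; apply: primGK; near: y; exact: lt_nbhsr.
- near=> y; apply: is_derive1_continuous; apply: is_derive_primG.
  by near: y; exact: lt_nbhsr.
- exact: is_derive_primG.
- by rewrite gt_eqF// c_gt0.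
Unshelve. all: by end_near. Qed.

End primitives.

(** * Concavity of [1 / Phi''] from that of [c / c'] *)

Section weighted_concavity.
Context {R : realType}.
Variable c : R -> R.
Hypothesis c_gt0 : forall x : R, 0 < x -> 0 < c x.
Hypothesis c_derivable : forall x : R, 0 < x -> derivable c x 1.
Hypothesis c'_continuous : {in `]0, +oo[, continuous (derive1 c)}.
Hypothesis c'_gt0 : forall x : R, 0 < x -> 0 < derive1 c x.
Hypothesis h_concave : concave_function `]0, +oo[ (fun x => c x / derive1 c x).
Local Notation c' := (derive1 c).
Local Notation G := (primG c).
Let h x := c x / c' x.

Let dc (x : R) : 0 < x -> is_derive x 1 c (c' x).
Proof. by move=> x0; rewrite derive1E; apply: derivableP; exact: c_derivable. Qed.

Let h_three_points (x y z : R) : 0 < x -> x < y -> y < z ->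
  h x * (z - y) + h z * (y - x) <= h y * (z - x).
Proof.
move=> x0 xy yz; have z0 : 0 < z by lra.
have zx : 0 < z - x by lra.
have t0 : 0 <= (z - y) / (z - x) by rewrite divr_ge0//; lra.
have t1 : (z - y) / (z - x) <= 1 by rewrite ler_pdivrMr// mul1r; lra.
have xpos : x \in (`]0, +oo[%classic : set R) by rewrite inE /= in_itv /= x0.
have zpos : z \in (`]0, +oo[%classic : set R) by rewrite inE /= in_itv /= z0.
set t := (z - y) / (z - x) in t0 t1.
have : - h (t * x + (1 - t) * z) <= t * - h x + (1 - t) * - h z.
  have := h_concave (Itv01 t0 t1) xpos zpos.
  by rewrite convRE.
have -> : t * x + (1 - t) * z = y by rewrite /t; field; rewrite gt_eqF.
have tE : t * (z - x) = z - y by rewrite /t divfK// gt_eqF.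
have uE : (1 - t) * (z - x) = y - x by rewrite mulrBl tE mul1r; ring.
rewrite -(ler_pM2r zx) -tE -uE.
move: (h x) (h y) (h z) => a1 a2 a3; nra.
Qed.

Let c'h (x : R) : 0 < x -> c' x * h x = c x.
Proof. by move=> x0; rewrite mulrC divfK// gt_eqF// c'_gt0. Qed.

Let dG (x : R) : 0 < x -> is_derive x 1 G (c x).
Proof. exact: is_derive_primG. Qed.

(* With [L] affine of slope [k], [(c L - (1 + k) G)' = c' (L - h)] because
   [c = c' h]; the sign of [L - h] is known on each side of the chord. *)
Let dcL (p q k x : R) : 0 < x ->
  is_derive x 1 (fun t => c t * (q + k * (t - p)) - (1 + k) * G t)
    (c' x * (q + k * (x - p) - h x)).
Proof.
move=> x0; have ? := dc x0; have ? := dG x0; apply: is_derive_eq.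
by rewrite /= /GRing.scale /= [RHS]mulrBr c'h//; ring.
Qed.

(** [c * h] is [1 / Phi''] read through [G], and [K] separates its chord slopes on the two sides of
    [y]. Formally its slope is [1 + h']; here [h'] is replaced by the slope [k] of the chord of [h]
    over [[y, z]], above which [h] lies between [y] and [z], and below which it lies to the left of
    [y]. *)
Let ch_slopes (x y z : R) : 0 < x -> x < y -> y < z -> exists K,
  c z * h z - c y * h y <= K * (G z - G y) /\
  K * (G y - G x) <= c y * h y - c x * h x.
Proof.
move=> x0 xy yz; have y0 : 0 < y by lra.
have zy : 0 < z - y by lra.
pose k := (h z - h y) / (z - y).
have kE : k * (z - y) = h z - h y by rewrite /k divfK// gt_eqF.
exists (1 + k); split.
- have [|w /andP[yw wz] e] := @MVT_is_derive R
    (fun t => c t * (h y + k * (t - y)) - (1 + k) * G t)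
    (fun x => c' x * (h y + k * (x - y) - h x)) y z yz.
    by move=> t /andP[yt _]; apply: dcL; lra.
  have w0 : 0 < w by lra.
  have : c' w * (h y + k * (w - y) - h w) * (z - y) <= 0.
    rewrite -mulrA pmulr_rle0 ?c'_gt0// mulrBl.
    have := h_three_points y0 yw wz.
    have -> : (h y + k * (w - y)) * (z - y) = h y * (z - y) + (h z - h y) * (w - y).
      by rewrite -kE; ring.
    by move: (h y) (h w) (h z) => a1 a2 a3; lra.
  rewrite -e subrr mulr0 addr0 kE.
  have -> : h y + (h z - h y) = h z by ring.
  by move: (c y * h y) (c z * h z) (G y) (G z) => a1 a2 a3 a4; lra.
- have [|w /andP[xw wy] e] := @MVT_is_derive R
    (fun t => c t * (h y + k * (t - y)) - (1 + k) * G t)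
    (fun x => c' x * (h y + k * (x - y) - h x)) x y xy.
    by move=> t /andP[xt _]; apply: dcL; lra.
  have above t : 0 < t -> t < y -> h t <= h y + k * (t - y).
    move=> t0 ty; rewrite -(ler_pM2r zy).
    have -> : (h y + k * (t - y)) * (z - y) = h y * (z - y) + (h z - h y) * (t - y).
      by rewrite -kE; ring.
    have := h_three_points t0 ty yz.
    by move: (h y) (h t) (h z) => a1 a2 a3; lra.
  have w0 : 0 < w by lra.
  have : 0 <= c' w * (h y + k * (w - y) - h w) * (y - x).
    by rewrite mulr_ge0 ?mulr_ge0 ?(ltW (c'_gt0 w0)) ?subr_ge0 ?above// ltW.
  rewrite -e subrr mulr0 addr0.
  have : c x * h x <= c x * (h y + k * (x - y)).
    by apply: ler_wpM2l; [rewrite ltW ?c_gt0|exact: above].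
  move: (c y * h y) (c x * h x) (c x * (h y + k * (x - y))) (G y) (G x) => a1 a2 a3 a4 a5.
  lra.
Qed.

Lemma concave_sqr_over_derive (x y z s : R) : 0 < x -> 0 < y -> 0 < z ->
  0 <= s <= 1 -> G z = (1 - s) * G x + s * G y ->
  (1 - s) * (c x ^+ 2 / c' x) + s * (c y ^+ 2 / c' y) <= c z ^+ 2 / c' z.
Proof.
have main u v w t : 0 < u -> u < w -> w < v -> 0 <= t <= 1 ->
    G w = (1 - t) * G u + t * G v ->
    (1 - t) * (c u * h u) + t * (c v * h v) <= c w * h w.
  move=> u0 uw wv /andP[t0 t1] Gw.
  have [K []] := ch_slopes u0 uw wv.
  move: (c u * h u) (c v * h v) (c w * h w) => a1 a2 a3.
  (* Weighting the right slope bound by [t] and the left one by [1 - t] produces the same multiple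
     of [K], which drops out. *)
  have -> : G v - G w = (1 - t) * (G v - G u) by rewrite Gw; ring.
  have -> : G w - G u = t * (G v - G u) by rewrite Gw; ring.
  move: (K) (G v - G u) => K' D h1 h2; nra.
have e u : c u ^+ 2 / c' u = c u * h u by rewrite /h expr2 mulrA.
rewrite !e => x0 y0 z0 /andP[s0 s1] Gz.
have GltE := primG_ltE c_gt0 c_derivable c'_gt0.
have [s_eq0|sn0] := eqVneq s 0.
  suff -> : z = x by rewrite s_eq0 subr0 mul1r mul0r addr0.
  rewrite -(primGK c_gt0 c_derivable c'_gt0 z0) Gz s_eq0 subr0 mul1r mul0r addr0.
  exact: primGK.
have [s_eq1|sn1] := eqVneq s 1.
  suff -> : z = y by rewrite s_eq1 subrr mul0r mul1r add0r.
  rewrite -(primGK c_gt0 c_derivable c'_gt0 z0) Gz s_eq1 subrr mul0r mul1r add0r.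
  exact: primGK.
have {}s0 : 0 < s by rewrite lt_neqAle eq_sym sn0.
have {}s1 : s < 1 by rewrite lt_neqAle sn1.
have [xy|yx|xy] := ltgtP x y.
- apply: main => //; last by rewrite !ltW.
  + by rewrite -(GltE _ _ x0 z0) Gz; have := primG_incr c_gt0 c_derivable c'_gt0 x0 xy; nra.
  + by rewrite -(GltE _ _ z0 y0) Gz; have := primG_incr c_gt0 c_derivable c'_gt0 x0 xy; nra.
- have m := main y x z (1 - s); rewrite subKr in m; rewrite addrC; apply: m => //.
  + by rewrite -(GltE _ _ y0 z0) Gz; have := primG_incr c_gt0 c_derivable c'_gt0 y0 yx; nra.
  + by rewrite -(GltE _ _ z0 x0) Gz; have := primG_incr c_gt0 c_derivable c'_gt0 y0 yx; nra.
  + by apply/andP; split; lra.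
  + by rewrite Gz addrC.
suff -> : z = x by rewrite -xy -mulrDl subrK mul1r.
rewrite -(primGK c_gt0 c_derivable c'_gt0 z0) Gz -xy -mulrDl subrK mul1r.
exact: primGK.
Qed.

End weighted_concavity.

(** * Admissibility of [H \o G^-1] *)

Section transfer.
Context {R : realType}.
Variable c : R -> R.
Hypothesis c_gt0 : forall x : R, 0 < x -> 0 < c x.
Hypothesis c_derivable : forall x : R, 0 < x -> derivable c x 1.
Hypothesis c'_continuous : {in `]0, +oo[, continuous (derive1 c)}.
Hypothesis c'_gt0 : forall x : R, 0 < x -> 0 < derive1 c x.
Hypothesis h_concave : concave_function `]0, +oo[ (fun x => c x / derive1 c x).
Local Notation c' := (derive1 c).
Local Notation G := (primG c).
Local Notation H := (primH c).
Local Notation K := (primGinv c).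

Let dc (x : R) : 0 < x -> is_derive x 1 c (c' x).
Proof. by move=> x0; rewrite derive1E; apply: derivableP; exact: c_derivable. Qed.

(** On []G p, G q[] every point is some [G x] with [x > 0] by the intermediate value theorem, so the
    full range of [G] need not be described; each clause is then checked at [G x], where the inverse
    function rule gives [K' = 1 / c]. *)
Lemma primGinv_admissible (p q : R) : 0 < p -> p <= q ->
  admissible_phi (G p) (G q) (H \o K) (fun u => ln (c (K u)))
    (fun u => c' (K u) / c (K u) ^+ 2).
Proof.
move=> p0 pq.
have onto u : G p < u < G q -> exists2 x, 0 < x & G x = u.
  move=> /andP[pu uq].
  have [|x /andP[px _] <-] := primG_onto c_gt0 c_derivable c'_gt0 p0 pq (u := u).
    by rewrite !ltW.
  by exists x => //; exact: lt_le_trans px.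
have GK x : 0 < x -> K (G x) = x by exact: primGK.
have dK x : 0 < x -> is_derive (G x) 1 K (c x)^-1 by exact: is_derive_primGinv.
split.
- move=> _ /onto[x x0 <-].
  have hH : is_derive (K (G x)) 1 H (c x * ln (c x)).
    by rewrite GK//; exact: is_derive_primH.
  have := is_derive1_comp hH (dK _ x0).
  by rewrite mulrAC divff ?gt_eqF ?c_gt0// mul1r GK.
- move=> _ /onto[x x0 <-].
  have hl : is_derive (K (G x)) 1 (fun y => ln (c y)) (c' x / c x).
    rewrite GK//; have := is_derive1_comp (is_derive1_ln (c_gt0 x0)) (dc x0).
    by rewrite mulrC.
  have := is_derive1_comp hl (dK _ x0).
  by rewrite -mulrA -expr2 -exprVn GK.
- move=> _ /onto[x x0 <-].
  have cK : {for G x, continuous K} := is_derive1_continuous (dK _ x0).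
  apply: (@continuous_comp _ _ _ K (fun y => c' y / c y ^+ 2)) => //.
  rewrite GK//; apply: cvgM; first by apply: c'_continuous; rewrite in_itv /= x0.
  apply: cvgV; first by rewrite expf_neq0// gt_eqF// c_gt0.
  apply: (continuous_cvg _ (@exprn_continuous R 2 _)).
  exact: is_derive1_continuous (dc x0).
- move=> _ /onto[x x0 <-].
  by rewrite GK// divr_gt0 ?c'_gt0// exprn_gt0// c_gt0.
- move=> u v s hu hv hs.
  have [x x0 ux] := onto _ hu; have [y y0 vy] := onto _ hv.
  have [z z0 wz] : exists2 z, 0 < z & G z = (1 - s) * u + s * v.
    apply: onto; move: hs hu hv => /andP[? ?] /andP[? ?] /andP[? ?].
    have [->|s_neq1] := eqVneq s 1; first by rewrite subrr mul0r add0r mul1r; apply/andP.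
    have {s_neq1}s1 : s < 1 by rewrite lt_neqAle s_neq1.
    by apply/andP; split; nra.
  rewrite -wz -ux -vy !GK// !invf_div.
  apply: concave_sqr_over_derive => //.
  by rewrite wz ux vy.
Qed.

End transfer.

(** * Chain rule and assembly of the inequality for [f] *)

Section composition.
Context {R : realType} {d : nat}.

(** Restricting [f] to the line through [x] directed by [v] reduces this to the one-variable chain
    rule. *)
Lemma is_derive_comp1 (phi : R -> R) (f : 'rV[R]_d -> R) (x v : 'rV[R]_d) (dphi df : R) :
  is_derive (f x) 1 phi dphi -> is_derive x v f df ->
  is_derive x v (phi \o f) (dphi * df).
Proof.
move=> hphi hf.
have hl : is_derive (0 : R) 1 (fun t : R => f (t *: v + x)) df.
  by apply: is_derive_congr hf => t; rewrite addr0 [t *: 1]mulr1.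
have hphi0 : is_derive (f (0 *: v + x)) 1 phi dphi by rewrite scale0r add0r.
have := is_derive1_comp hphi0 hl.
by apply: is_derive_congr => t; rewrite /= addr0 [t *: 1]mulr1.
Qed.

Lemma C1_b_0_partials (f : 'rV[R]_d -> R) : C1_b_0 f ->
  [/\ exists M, bounded_partials f (fun i x => grad f x ord0 i) M,
      exists m, 0 < m /\ (forall x, m <= f x) &
      exists N, forall x, f x <= N].
Proof.
move=> [[df cdf] [N fN] [M fM] inf0]; split.
- exists M; split.
  + by move=> x; exact: differentiable_continuous.
  + move=> i x; rewrite mxE; apply: derivableP; apply: diff_derivable; exact: df.
  + move=> i x; apply: (@continuous_comp _ _ _ (grad f) (fun v => v ord0 i)).
      exact: cdf.
    exact: coord_continuous.
  + move=> i x; apply: le_trans (fM x); rewrite /enorm.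
    rewrite -[leLHS]ger0_norm// -sqrtr_sqr ler_sqrt; last first.
      by apply: sumr_ge0 => j _; exact: sqr_ge0.
    rewrite real_normK ?num_real// (bigD1 i)//= lerDl.
    by apply: sumr_ge0 => j _; exact: sqr_ge0.
(* [inf] is a lower bound only of a set bounded below, which the bound on [|f|] ensures. *)
- exists (inf (range f)); split=> // x; apply: ge_inf; last by exists x.
  by exists (- N) => _ [y _ <-]; have := fN y; rewrite ler_norml => /andP[].
- by exists N => x; exact: le_trans (ler_norm _) (fN x).
Qed.

End composition.

Theorem corollary4p1 (R : realType) (d : nat) (c : R -> R) (f : 'rV[R]_d -> R)
  (d_ge1 : (1 <= d)%N)
  (c_gt0 : forall x : R, 0 < x -> 0 < c x)
  (c_derivable : forall x : R, 0 < x -> derivable c x 1)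
  (c'_continuous : {in `]0, +oo[, continuous (derive1 c)})
  (c'_gt0 : forall x : R, 0 < x -> 0 < derive1 c x)
  (cdivc'_concave : concave_function `]0, +oo[ (fun x => c x / derive1 c x))
  (fC : C1_b_0 f) :
  \int[std_gaussian d]_x primH c (f x) <=
  2^-1 * \int[std_gaussian d]_x (derive1 c (f x) * enorm (grad f x) ^+ 2) +
  primH c (primGinv c (\int[std_gaussian d]_x `|primG c (f x)|)).
Proof.
have [[M [cf df cgf gfM]] [m [m0 mf]] [N fN]] := C1_b_0_partials fC.
have f0 x : 0 < f x by exact: lt_le_trans (mf x).
have mN : m <= N by exact: le_trans (mf 0) (fN 0).
have N0 : 0 < N by exact: lt_le_trans mN.
have GleE := primG_leE c_gt0 c_derivable c'_gt0.
(* The margins [m / 2 < m] and [N < N + 1] place the compact interval [[G m, G N]], which contains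
   the values of [G(f)], strictly inside the open interval of admissibility. *)
have m20 : 0 < m / 2 by rewrite divr_gt0.
have mN1 : m / 2 <= N + 1 by lra.
have adm := primGinv_admissible c_gt0 c_derivable c'_continuous c'_gt0
  cdivc'_concave m20 mN1.
have lo : primG c (m / 2) < primG c m by apply: primG_incr => //; lra.
have hi : primG c N < primG c (N + 1) by apply: primG_incr => //; lra.
have GK x : primGinv c (primG c (f x)) = f x by exact: primGK.
have cfcont : continuous (fun x => c (f x)).
  move=> x; apply: (@continuous_comp _ _ _ f c); first exact: cf.
  by apply: differentiable_continuous; apply/derivable1_diffP; exact: c_derivable.
have cM x : `|c (f x)| <= c N.
  by rewrite gtr0_norm ?c_gt0//; exact: (c_incr c_derivable c'_gt0).
have gb : bounded_partials (fun x => primG c (f x))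
    (fun i x => c (f x) * grad f x ord0 i) (c N * M).
  split.
  - move=> x; apply: (@continuous_comp _ _ _ f (primG c)); first exact: cf.
    exact: is_derive1_continuous (is_derive_primG c_gt0 c_derivable c'_gt0 (f0 x)).
  - move=> i x; apply: (@is_derive_comp1 R d (primG c)) => //.
    exact: is_derive_primG.
  - by move=> i x; exact: (cvgM (cfcont x) (cgf i x)).
  - by move=> i x; rewrite normrM ler_pM// cM.
have gab x : primG c m <= primG c (f x) <= primG c N by rewrite !GleE// mf fN.
have eH : \int[std_gaussian d]_x primH c (f x) =
    \int[std_gaussian d]_x primH c (primGinv c (primG c (f x))).
  by apply: eq_Rintegral => x _; exact: (congr1 (primH c) (esym (GK x))).
have eG : \int[std_gaussian d]_x `|primG c (f x)| =
    \int[std_gaussian d]_x primG c (f x).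
  by apply: eq_Rintegral => x _; exact: (ger0_norm (primG_ge0 c_gt0 _)).
have egrad : \int[std_gaussian d]_x (derive1 c (f x) * enorm (grad f x) ^+ 2) =
    \int[std_gaussian d]_x (derive1 c (primGinv c (primG c (f x))) /
      c (primGinv c (primG c (f x))) ^+ 2 *
      \sum_(i < d) (c (f x) * grad f x ord0 i) ^+ 2).
  apply: eq_Rintegral => x _; rewrite GK /enorm sqr_sqrtr; last first.
    by apply: sumr_ge0 => i _; exact: sqr_ge0.
  have -> : \sum_(i < d) (c (f x) * grad f x ord0 i) ^+ 2 =
      c (f x) ^+ 2 * \sum_(i < d) grad f x ord0 i ^+ 2.
    by rewrite mulr_sumr; apply: eq_bigr => i _; rewrite exprMn.
  have c2 : c (f x) ^+ 2 != 0 := expf_neq0 2 (lt0r_neq0 (c_gt0 _ (f0 x))).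
  by rewrite mulrA (divfK c2).
rewrite eH eG egrad addrC.
by have := phi_sobolev_gaussian adm lo hi gb gab; rewrite /comp.
Qed.
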